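(* The segment diffeomorphism groupoid $\mathrm{BDiff}(I)\rightrightarrows P$ has a one-dimensional central extension given by the groupoid $2$-cocycle $$\chi(\phi,\psi)=\int_a^b\log(\phi_x\circ\psi)\,d\log(\psi_x),\qquad \mathrm{src}(\psi)=[a,b],$$ for composable $\phi,\psi$; that is, $\chi(\phi,\psi\circ\eta)+\chi(\psi,\eta)=\chi(\phi\circ\psi,\eta)+\chi(\phi,\psi)$ for all composable triples $(\phi,\psi,\eta)$. The corresponding algebroid $2$-cocycle is $$\Omega\bigl(u(x)\partial_x,v(x)\partial_x\bigr)=\int_a^b\bigl(u_xv_{xx}-u_{xx}v_x\bigr)\,dx$$ for vector fields $u\,\partial_x,v\,\partial_x$ on the same interval $[a,b]$.
   Context: $P=\{(a,b)\in\mathbb R^2: a<b\}$, a point $(a,b)$ being identified with the interval $[a,b]$. Arrows of $\mathrm{BDiff}(I)$ with source $(a,b)$ are orientation-preserving smooth (up to the boundary) diffeomorphisms $\phi$ from $[a,b]$ onto the image $[\phi(a),\phi(b)]\subset\mathbb R$; the target is $(\phi(a),\phi(b))$; composition is composition of maps when source and target match. The central extension given by a cocycle $\chi$ is $\mathrm{BDiff}(I)\times\mathbb R$ with product $(\phi,t)(\psi,s)=(\phi\circ\psi,t+s+\chi(\phi,\psi))$. The algebroid of $\mathrm{BDiff}(I)$ is the vector bundle over $P$ whose fiber over $(a,b)$ is the space of all smooth vector fields $u(x)\partial_x$ on $[a,b]$ (not necessarily vanishing at the endpoints). Smooth sections are families $\mathbf u=u(x,a,b)\partial_x$ smooth on $\{(x,a,b):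 a\le x\le b,\ a<b\}$. The anchor is $\#\mathbf u=u(a,a,b)\partial_a+u(b,a,b)\partial_b$ and the bracket is $[\![\mathbf u,\mathbf v]\!]=[\mathbf u,\mathbf v]+L_{\#\mathbf u}\mathbf v-L_{\#\mathbf v}\mathbf u$, where $[\mathbf u,\mathbf v]=(uv_x-vu_x)\partial_x$ for fixed $(a,b)$ and $L_{\#\mathbf u}$ differentiates in the parameters $(a,b)$ at fixed $x$. An algebroid $2$-cocycle is a fiberwise skew-symmetric bilinear form $\Omega$, taking smooth sections to smooth functions on $P$, such that the cyclic sum over $\mathbf u,\mathbf v,\mathbf w$ of $L_{\#\mathbf u}(\Omega(\mathbf v,\mathbf w))-\Omega([\![\mathbf u,\mathbf v]\!],\mathbf w)$ vanishes. A bisection is a smooth map $\phi$ assigning to each $q\in P$ an arrow $\phi(q)$ with source $q$, such that $q\mapsto\mathrm{trg}(\phi(q))$ is a diffeomorphism of $P$. The algebroid cocycle corresponding to a groupoid cocycle $\chi$ is $$\Omega(\mathbf u,\mathbf v)(q)=\frac{\partial^2}{\partial t\,\partial s}\Big|_{t=s=0}\Bigl(\chi\bigl(\phi^t(\mathrm{trg}(\psi^s(q))),\psi^s(q)\bigr)-\chi\bigl(\psi^s(\mathrm{trg}(\phi^t(q))),\phi^t(q)\bigr)\Bigr),$$ where $\phi^t,\psi^s$ are smooth one-parameter families of bisections through the identity bisection at $t=0$, $s=0$, with tangent vectors $\mathbf u,\mathbf v$ there. *)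

(* Defs.v *)
From Stdlib Require Import Reals RelationClasses.
From Coquelicot Require Import Coquelicot.
Open Scope R_scope.

Definition dirderiv {V : NormedModule R_AbsRing} (f : V -> R) (v p : V) : R :=
  Derive (fun h : R => f (plus p (scal h v))) 0.

(** Only used on open sets of finite-dimensional spaces (products of copies of
    [R]), where it is the usual class C^k. *)
Fixpoint Ck {V : NormedModule R_AbsRing} (k : nat) (U : V -> Prop) (f : V -> R)
    : Prop :=
  match k with
  | O => forall p, U p -> continuous f p
  | S k' => (forall p, U p -> ex_filterdiff f (locally p)) /\
            (forall v, Ck k' U (dirderiv f v))
  end.

(** Smoothness up to the boundary on a set [A] contained in the closure of its
    interior: [f] is smooth on an open neighbourhood of [A].  A smooth function
    on [A] is thus represented by a total function, any extension of it that is
    smooth near [A]; only the restriction to [A] is meaningful, and derivatives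
    of the representative at boundary points of [A] do not depend on the choice
    of the extension. *)
Definition smooth_on {V : NormedModule R_AbsRing} (A : V -> Prop) (f : V -> R)
    : Prop :=
  exists U : V -> Prop,
    open U /\ (forall p, A p -> U p) /\ (forall k, Ck k U f).

Definition P (q : R * R) : Prop := fst q < snd q.

Definition seg (q : R * R) (x : R) : Prop := fst q <= x <= snd q.

(** The triples [(x, (a, b))] with [a <= x <= b] and [a < b]. *)
Definition fibers (p : R * (R * R)) : Prop := P (snd p) /\ seg (snd p) (fst p).

Record arrow := Arrow { src : R * R; fn : R -> R }.

Definition trg (g : arrow) : R * R := (fn g (fst (src g)), fn g (snd (src g))).

Definition arrow_eq (g h : arrow) : Prop :=
  src g = src h /\ forall x, seg (src g) x -> fn g x = fn h x.

Definition is_bdiff (g : arrow) : Prop :=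
  P (src g) /\
  smooth_on (seg (src g)) (fn g) /\
  (forall x y, seg (src g) x -> seg (src g) y -> x < y -> fn g x < fn g y) /\
  exists k : R -> R,
    smooth_on (seg (trg g)) k /\
    (forall x, seg (src g) x -> k (fn g x) = x) /\
    (forall y, seg (trg g) y -> seg (src g) (k y) /\ fn g (k y) = y).

Definition composable (g h : arrow) : Prop := src g = trg h.

Definition comp (g h : arrow) : arrow :=
  Arrow (src h) (fun x => fn g (fn h x)).

Definition id_arrow (q : R * R) : arrow := Arrow q (fun x => x).

(** A groupoid whose arrows are the elements of [A] satisfying [arr], taken up
    to [eqv], and whose objects are the elements of [Ob] satisfying [obj];
    [mul g h] is meaningful when [source g = target h]. *)
Record is_groupoid {Ob A : Type} (obj : Ob -> Prop) (arr : A -> Prop)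
    (eqv : A -> A -> Prop) (source target : A -> Ob)
    (one : Ob -> A) (mul : A -> A -> A) : Prop := {
  gpd_eqv : Equivalence eqv;
  gpd_obj : forall g, arr g -> obj (source g) /\ obj (target g);
  gpd_source_eqv : forall g h, eqv g h -> source g = source h;
  gpd_target_eqv : forall g h, arr g -> arr h -> eqv g h -> target g = target h;
  gpd_one : forall q, obj q ->
    arr (one q) /\ source (one q) = q /\ target (one q) = q;
  gpd_mul : forall g h, arr g -> arr h -> source g = target h ->
    arr (mul g h) /\ source (mul g h) = source h /\ target (mul g h) = target g;
  gpd_mul_eqv : forall g g' h h', arr g -> arr g' -> arr h -> arr h' ->
    eqv g g' -> eqv h h' -> source g = target h -> eqv (mul g h) (mul g' h');
  gpd_assoc : forall g h k, arr g -> arr h -> arr k ->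
    source g = target h -> source h = target k ->
    eqv (mul g (mul h k)) (mul (mul g h) k);
  gpd_one_l : forall g, arr g -> eqv (mul (one (target g)) g) g;
  gpd_one_r : forall g, arr g -> eqv (mul g (one (source g))) g;
  gpd_inv : forall g, arr g -> exists h,
    arr h /\ source h = target g /\ target h = source g /\
    eqv (mul g h) (one (target g)) /\ eqv (mul h g) (one (source g))
}.

Definition groupoid_cocycle (c : arrow -> arrow -> R) : Prop :=
  (forall g g' h h', is_bdiff g -> is_bdiff g' -> is_bdiff h -> is_bdiff h' ->
     arrow_eq g g' -> arrow_eq h h' -> composable g h -> c g h = c g' h') /\
  (forall g h k, is_bdiff g -> is_bdiff h -> is_bdiff k ->
     composable g h -> composable h k ->
     c g (comp h k) + c h k = c (comp g h) k + c g h).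

Definition ext_mul (c : arrow -> arrow -> R) (e f : arrow * R) : arrow * R :=
  (comp (fst e) (fst f), snd e + snd f + c (fst e) (fst f)).

Definition ext_eq (e f : arrow * R) : Prop :=
  arrow_eq (fst e) (fst f) /\ snd e = snd f.

(** The copy of [R] over the unit at [q]; the shift makes [ext_line c q 0] the
    unit of the extension even if [c] does not vanish on units. *)
Definition ext_line (c : arrow -> arrow -> R) (q : R * R) (r : R) : arrow * R :=
  (id_arrow q, r - c (id_arrow q) (id_arrow q)).

Definition central_extension (c : arrow -> arrow -> R) : Prop :=
  is_groupoid P (fun e : arrow * R => is_bdiff (fst e)) ext_eq
    (fun e => src (fst e)) (fun e => trg (fst e))
    (fun q => ext_line c q 0) (ext_mul c) /\
  (forall q r s, P q ->
     ext_eq (ext_mul c (ext_line c q r) (ext_line c q s)) (ext_line c q (r + s))) /\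
  (forall e r, is_bdiff (fst e) ->
     ext_eq (ext_mul c (ext_line c (trg (fst e)) r) e)
            (ext_mul c e (ext_line c (src (fst e)) r))).

Definition chi (g h : arrow) : R :=
  RInt (fun x => ln (Derive (fn g) (fn h x)) * Derive (fun y => ln (Derive (fn h) y)) x)
    (fst (src h)) (snd (src h)).

(** A section is [q |-> u q], with [u q] the coefficient of a vector field on
    the segment [q]. *)
Definition smooth_section (u : R * R -> R -> R) : Prop :=
  smooth_on fibers (fun p => u (snd p) (fst p)).

Definition lie_anchor (u : R * R -> R -> R) (f : R * R -> R) (q : R * R) : R :=
  u q (fst q) * Derive (fun a => f (a, snd q)) (fst q) +
  u q (snd q) * Derive (fun b => f (fst q, b)) (snd q).

Definition bracket (u v : R * R -> R -> R) (q : R * R) (x : R) : R :=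
  (u q x * Derive (v q) x - v q x * Derive (u q) x)
  + lie_anchor u (fun q' => v q' x) q - lie_anchor v (fun q' => u q' x) q.

Definition fiberwise_skew_form (W : R * R -> (R -> R) -> (R -> R) -> R) : Prop :=
  forall q, P q -> forall u v w : R -> R,
    smooth_on (seg q) u -> smooth_on (seg q) v -> smooth_on (seg q) w ->
    ((forall x, seg q x -> u x = v x) -> W q u w = W q v w) /\
    W q u v = - W q v u /\
    (forall c : R, W q (fun x => c * u x + v x) w = c * W q u w + W q v w).

Definition algebroid_cocycle (W : R * R -> (R -> R) -> (R -> R) -> R) : Prop :=
  fiberwise_skew_form W /\
  (forall u v, smooth_section u -> smooth_section v ->
     smooth_on P (fun q => W q (u q) (v q))) /\
  (forall u v w, smooth_section u -> smooth_section v -> smooth_section w ->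
     forall q, P q ->
     (lie_anchor u (fun q' => W q' (v q') (w q')) q - W q (bracket u v q) (w q))
     + (lie_anchor v (fun q' => W q' (w q') (u q')) q - W q (bracket v w q) (u q))
     + (lie_anchor w (fun q' => W q' (u q') (v q')) q - W q (bracket w u q) (v q))
     = 0).

Definition Omega (q : R * R) (u v : R -> R) : R :=
  RInt (fun x => Derive u x * Derive_n v 2 x - Derive_n u 2 x * Derive v x)
    (fst q) (snd q).

Definition diffeo_P (T : R * R -> R * R) : Prop :=
  let smooth_self_map (F : R * R -> R * R) :=
    (forall q, P q -> P (F q)) /\
    smooth_on P (fun q => fst (F q)) /\ smooth_on P (fun q => snd (F q)) in
  smooth_self_map T /\
  exists T', smooth_self_map T' /\
    forall q, P q -> T' (T q) = q /\ T (T' q) = q.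

(** A bisection is given by the maps [phi q] of its arrows. *)
Definition at_source (phi : R * R -> R -> R) (q : R * R) : arrow := Arrow q (phi q).

Definition bisection (phi : R * R -> R -> R) : Prop :=
  smooth_on fibers (fun p => phi (snd p) (fst p)) /\
  (forall q, P q -> is_bdiff (at_source phi q)) /\
  diffeo_P (fun q => trg (at_source phi q)).

Definition bisection_family (phi : R -> R * R -> R -> R) (u : R * R -> R -> R)
    : Prop :=
  exists eps : posreal,
    smooth_on
      (fun p : R * (R * (R * R)) => Rabs (fst p) < eps /\ fibers (snd p))
      (fun p => phi (fst p) (snd (snd p)) (fst (snd p))) /\
    (forall t, Rabs t < eps -> bisection (phi t)) /\
    (forall q x, P q -> seg q x ->
       phi 0 q x = x /\ is_derive (fun t => phi t q x) 0 (u q x)).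

Definition is_mixed_derive (F : R -> R -> R) (l : R) : Prop :=
  locally 0 (fun t => ex_derive (F t) 0) /\
  is_derive (fun t => Derive (F t) 0) 0 l.

Definition corresponding_cocycle (c : arrow -> arrow -> R)
    (W : R * R -> (R -> R) -> (R -> R) -> R) : Prop :=
  forall (u v : R * R -> R -> R) (phi psi : R -> R * R -> R -> R),
    smooth_section u -> smooth_section v ->
    bisection_family phi u -> bisection_family psi v ->
    forall q, P q ->
    is_mixed_derive
      (fun t s =>
         c (at_source (phi t) (trg (at_source (psi s) q))) (at_source (psi s) q)
         - c (at_source (psi s) (trg (at_source (phi t) q))) (at_source (phi t) q))
      (W q (u q) (v q)).

(* Main.v *)
From Stdlib Require Import Reals Lra ClassicalEpsilon.
From Coquelicot Require Import Coquelicot.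
From Stdlib Require Import List RelationClasses.
Require Import Defs.
Open Scope R_scope.

(** The groupoid part is the chain rule [log (h o k)_x = log h_x o k + log k_x].
    It writes the two sides of the cocycle identity as sums of the same three
    integrals over the source segment of [k], once the integral over the source
    of [h] is pulled back by [k] ([chi_cocycle_identity]).  The cocycle vanishes
    when one argument is a unit, so the extension has units [(id, 0)], the lines
    over the units are central, and the inverse of [(g, t)] is
    [(g^-1, - t - chi (g, g^-1))], where [chi (g, g^-1) = chi (g^-1, g)].

    For the algebroid cocycle, [lie_anchor] is a directional derivative in the
    endpoints [q = (a, b)].  Applied to [q |-> Omega (v, w)] it gives the integral
    of the derivative of the integrand plus the contribution of the moving
    endpoints, which is the integral of a total [x]-derivative
    ([lie_anchor_Omega]).  The cyclic sum becomes the integral of one function of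
    [x], which vanishes identically by the product rule and the symmetry of
    second derivatives ([cyclic_sum_zero]).

    For the correspondence, [chi (phi^t, psi^s)] is the integral of
    [A (t, s, x) * B (s, x)], where [A] is [log phi^t_x] evaluated along [psi^s]
    and [B] is the [x]-derivative of [log psi^s_x].  Both factors vanish at
    [t = s = 0] and [B] does not depend on [t], so the mixed derivative of the
    product at the origin is [A_t * B_s = u_x * v_xx] ([mixed_chi_integrand]).
    Exchanging the two families and subtracting gives the integrand of [Omega].

    All this rests on a calculus of functions that are [Ck] for every [k] on an
    open set: stability under products, composition and logarithm, symmetry of
    directional derivatives ([dirderiv_comm]), and differentiation under the
    integral sign with moving endpoints ([is_derive_RInt_line]), where the tube
    lemma provides uniformity over the segment of integration. *)
(** * Calculus of smooth functions on open sets *)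

(** Smoothness on an open set: of class [Ck] for every [k]. *)
Definition smooth {V : NormedModule R_AbsRing} (U : V -> Prop) (f : V -> R) : Prop :=
  forall k, Ck k U f.

Section Smooth.
Context {V : NormedModule R_AbsRing}.
Implicit Types (U : V -> Prop) (f g : V -> R) (p v w : V).

Lemma is_derive_along (p v : V) (h : R) :
  is_derive (fun h : R => plus p (scal h v)) h v.
Proof.
  apply (filterdiff_ext_lin _ (fun k : R_AbsRing => plus zero (scal k v))).
  - apply (filterdiff_plus_fct (fun _ : R_AbsRing => p) (fun h => scal h v)).
    + apply (filterdiff_const p).
    + apply filterdiff_linear, is_linear_scal_l.
  - intros y. apply plus_zero_l.
Qed.

Lemma plus_scal_zero (p v : V) : plus p (scal 0 v) = p.
Proof.
  rewrite <- (plus_zero_r p) at 2. apply f_equal, (scal_zero_l v).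
Qed.

Lemma filterdiff_is_derive_along f p (l : V -> R) v :
  filterdiff f (locally p) l ->
  is_derive (fun h : R => f (plus p (scal h v))) 0 (l v).
Proof.
  intros Hf. pose proof Hf as [Hl _].
  eapply filterdiff_ext_lin.
  - apply (filterdiff_comp' (fun h : R => plus p (scal h v)) f).
    + apply is_derive_along.
    + rewrite plus_scal_zero. exact Hf.
  - intros y. apply (linear_scal _ Hl).
Qed.

Lemma filterdiff_dirderiv f p (l : V -> R) v :
  filterdiff f (locally p) l -> dirderiv f v p = l v.
Proof.
  intros Hf. apply is_derive_unique, filterdiff_is_derive_along, Hf.
Qed.

Lemma ex_filterdiff_dirderiv f p :
  ex_filterdiff f (locally p) ->
  filterdiff f (locally p) (fun v => dirderiv f v p).
Proof.
  intros [l Hl]. eapply filterdiff_ext_lin; [exact Hl |].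
  intros v. symmetry. apply filterdiff_dirderiv, Hl.
Qed.

Lemma open_along U p v :
  open U -> U p -> locally 0 (fun h : R => U (plus p (scal h v))).
Proof.
  intros HU Hp.
  assert (Hc : continuous (fun h : R => plus p (scal h v)) 0).
  { exact (ex_derive_continuous _ _ (ex_intro _ v (is_derive_along p v 0))). }
  apply (Hc U). apply HU. rewrite plus_scal_zero. exact Hp.
Qed.

Lemma dirderiv_ext U f g v p :
  open U -> (forall p, U p -> f p = g p) -> U p ->
  dirderiv f v p = dirderiv g v p.
Proof.
  intros HU Hfg Hp. apply Derive_ext_loc.
  generalize (open_along U p v HU Hp). apply filter_imp. intros h. apply Hfg.
Qed.

Lemma Ck_ext k : forall U f g,
  open U -> (forall p, U p -> f p = g p) -> Ck k U f -> Ck k U g.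
Proof.
  induction k as [|k IH]; intros U f g HU Hfg Hf.
  - intros p Hp. eapply continuous_ext_loc; [| exact (Hf p Hp)].
    apply filter_imp with (2 := HU p Hp). intros y Hy. apply Hfg, Hy.
  - destruct Hf as [Hf1 Hf2]. split.
    + intros p Hp. destruct (Hf1 p Hp) as [l Hl]. exists l.
      apply filterdiff_ext_locally with (2 := Hl).
      apply filter_imp with (2 := HU p Hp). exact (Hfg).
    + intros v. apply IH with (3 := Hf2 v); [exact HU |].
      intros p. apply dirderiv_ext; assumption.
Qed.

Lemma Ck_subset k : forall U U' f, (forall p, U' p -> U p) -> Ck k U f -> Ck k U' f.
Proof.
  induction k as [|k IH]; intros U U' f HU Hf.
  - intros p Hp. apply Hf, HU, Hp.
  - destruct Hf as [Hf1 Hf2]. split.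
    + intros p Hp. apply Hf1, HU, Hp.
    + intros v. apply IH with (1 := HU), Hf2.
Qed.

Lemma Ck_pred k : forall U f, Ck (S k) U f -> Ck k U f.
Proof.
  induction k as [|k IH]; intros U f [Hf1 Hf2].
  - intros p Hp. apply (filterdiff_continuous f), Hf1, Hp.
  - split; [exact Hf1 |]. intros v. apply IH, Hf2.
Qed.

Lemma Ck_const k : forall U (c : R), open U -> Ck k U (fun _ => c).
Proof.
  induction k as [|k IH]; intros U c HU.
  - intros p _. apply continuous_const.
  - split.
    + intros p _. eexists. apply filterdiff_const.
    + intros v. apply Ck_ext with (f := fun _ => 0); [exact HU | | apply IH, HU].
      intros p _. unfold dirderiv. rewrite Derive_const. reflexivity.
Qed.

Lemma filterdiff_Rplus f g p (lf lg : V -> R) :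
  filterdiff f (locally p) lf -> filterdiff g (locally p) lg ->
  filterdiff (fun q => f q + g q) (locally p) (fun v => lf v + lg v).
Proof. intros Hf Hg. exact (filterdiff_plus_fct f g lf lg Hf Hg). Qed.

Lemma filterdiff_Rmult f g p (lf lg : V -> R) :
  filterdiff f (locally p) lf -> filterdiff g (locally p) lg ->
  filterdiff (fun q => f q * g q) (locally p) (fun v => lf v * g p + f p * lg v).
Proof. intros Hf Hg. exact (filterdiff_mult_fct f g p lf lg Rmult_comm Hf Hg). Qed.

Lemma dirderiv_plus f g v p :
  ex_filterdiff f (locally p) -> ex_filterdiff g (locally p) ->
  dirderiv (fun q => f q + g q) v p = dirderiv f v p + dirderiv g v p.
Proof.
  intros Hf%ex_filterdiff_dirderiv Hg%ex_filterdiff_dirderiv.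
  exact (filterdiff_dirderiv _ _ _ v (filterdiff_Rplus _ _ _ _ _ Hf Hg)).
Qed.

Lemma dirderiv_minus (f g : V -> R) (v p : V) :
  ex_filterdiff f (locally p) -> ex_filterdiff g (locally p) ->
  dirderiv (fun q => f q - g q) v p = dirderiv f v p - dirderiv g v p.
Proof.
  intros Hf%ex_filterdiff_dirderiv Hg%ex_filterdiff_dirderiv.
  exact (filterdiff_dirderiv _ _ _ v (filterdiff_minus_fct f g _ _ Hf Hg)).
Qed.

Lemma dirderiv_mult f g v p :
  ex_filterdiff f (locally p) -> ex_filterdiff g (locally p) ->
  dirderiv (fun q => f q * g q) v p = dirderiv f v p * g p + f p * dirderiv g v p.
Proof.
  intros Hf%ex_filterdiff_dirderiv Hg%ex_filterdiff_dirderiv.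
  exact (filterdiff_dirderiv _ _ _ v (filterdiff_Rmult _ _ _ _ _ Hf Hg)).
Qed.

Lemma Ck_plus k : forall U f g,
  open U -> Ck k U f -> Ck k U g -> Ck k U (fun p => f p + g p).
Proof.
  induction k as [|k IH]; intros U f g HU Hf Hg.
  - intros p Hp. apply (continuous_plus f g); [apply Hf | apply Hg]; exact Hp.
  - destruct Hf as [Hf1 Hf2], Hg as [Hg1 Hg2]. split.
    + intros p Hp. destruct (Hf1 p Hp) as [lf Hlf], (Hg1 p Hp) as [lg Hlg].
      eexists. apply filterdiff_Rplus; eassumption.
    + intros v. eapply Ck_ext with (3 := IH U _ _ HU (Hf2 v) (Hg2 v)); [exact HU |].
      intros p Hp. symmetry. apply dirderiv_plus; auto.
Qed.

Lemma Ck_mult k : forall U f g,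
  open U -> Ck k U f -> Ck k U g -> Ck k U (fun p => f p * g p).
Proof.
  induction k as [|k IH]; intros U f g HU Hf Hg.
  - intros p Hp. apply (continuous_mult f g); [apply Hf | apply Hg]; exact Hp.
  - pose proof (Ck_pred _ _ _ Hf) as Hf0. pose proof (Ck_pred _ _ _ Hg) as Hg0.
    destruct Hf as [Hf1 Hf2], Hg as [Hg1 Hg2]. split.
    + intros p Hp. destruct (Hf1 p Hp) as [lf Hlf], (Hg1 p Hp) as [lg Hlg].
      eexists. apply filterdiff_Rmult; eassumption.
    + intros v.
      eapply Ck_ext with
        (3 := Ck_plus k U _ _ HU (IH U _ _ HU (Hf2 v) Hg0) (IH U _ _ HU Hf0 (Hg2 v)));
        [exact HU |].
      intros p Hp. symmetry. apply dirderiv_mult; auto.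
Qed.

Lemma smooth_ext U f g :
  open U -> (forall p, U p -> f p = g p) -> smooth U f -> smooth U g.
Proof. intros HU Hfg Hf k. apply Ck_ext with (3 := Hf k); assumption. Qed.

Lemma smooth_subset U U' f : (forall p, U' p -> U p) -> smooth U f -> smooth U' f.
Proof. intros HU Hf k. apply Ck_subset with (1 := HU), Hf. Qed.

Lemma smooth_const U (c : R) : open U -> smooth U (fun _ => c).
Proof. intros HU k. apply Ck_const, HU. Qed.

Lemma smooth_plus U f g :
  open U -> smooth U f -> smooth U g -> smooth U (fun p => f p + g p).
Proof. intros HU Hf Hg k. apply Ck_plus; auto. Qed.

Lemma smooth_mult U f g :
  open U -> smooth U f -> smooth U g -> smooth U (fun p => f p * g p).
Proof. intros HU Hf Hg k. apply Ck_mult; auto. Qed.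

Lemma smooth_scal U (c : R) f : open U -> smooth U f -> smooth U (fun p => c * f p).
Proof. intros HU. apply smooth_mult, smooth_const; exact HU. Qed.

Lemma smooth_minus U f g :
  open U -> smooth U f -> smooth U g -> smooth U (fun p => f p - g p).
Proof.
  intros HU Hf Hg. apply smooth_ext with (f := fun p => f p + (-1) * g p);
    [exact HU | intros; ring | auto using smooth_plus, smooth_scal].
Qed.

Lemma smooth_dirderiv U f v : smooth U f -> smooth U (dirderiv f v).
Proof. intros Hf k. apply (Hf (S k)). Qed.

Lemma smooth_ex_filterdiff U f p : smooth U f -> U p -> ex_filterdiff f (locally p).
Proof. intros Hf. apply (Hf 1%nat). Qed.

Lemma smooth_continuous U f p : smooth U f -> U p -> continuous f p.
Proof. intros Hf. apply (Hf 0%nat). Qed.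

Lemma smooth_linear U (l : V -> R) : open U -> is_linear l -> smooth U l.
Proof.
  intros HU Hl [|k].
  - intros p _. apply (filterdiff_continuous l). eexists.
    apply filterdiff_linear, Hl.
  - split.
    + intros p _. eexists. apply filterdiff_linear, Hl.
    + intros v. apply Ck_ext with (f := fun _ => l v); [exact HU | | apply Ck_const, HU].
      intros p _. symmetry. apply filterdiff_dirderiv, filterdiff_linear, Hl.
Qed.

End Smooth.

Section Maps.
Context {V W : NormedModule R_AbsRing}.

(** [combination l] is the map [p |-> sum_i g_i(p) e_i], [l] being the list of the
    pairs [(g_i, e_i)]. *)
Fixpoint combination (l : list ((V -> R) * W)) (p : V) : W :=
  match l with
  | nil => zero
  | (g, e) :: l' => plus (scal (g p) e) (combination l' p)
  end.

(** Maps between normed modules that are finite sums of constant vectors with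
    smooth coefficients.  Every smooth map into a finite-dimensional space is of
    this form, and the form makes the chain rule a finite sum. *)
Definition smooth_map (U : V -> Prop) (G : V -> W) : Prop :=
  exists l : list ((V -> R) * W),
    Forall (fun ge => smooth U (fst ge)) l /\
    forall p, U p -> G p = combination l p.

(** Derivative of [f] composed with a combination, by the chain rule. *)
Fixpoint chain_sum (l : list ((V -> R) * W)) (f : W -> R) (v p : V) (y : W) : R :=
  match l with
  | nil => 0
  | (g, e) :: l' => dirderiv g v p * dirderiv f e y + chain_sum l' f v p y
  end.

Lemma filterdiff_scal_vector (g : V -> R) (e : W) p (lg : V -> R) :
  filterdiff g (locally p) lg ->
  filterdiff (fun q => scal (g q) e) (locally p) (fun v => scal (lg v) e).
Proof.
  intros Hg.
  assert (Hs : filterdiff (U := R_NormedModule) (fun k : R => scal k e)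
                 (locally (g p)) (fun k : R => scal k e)).
  { exact (filterdiff_linear _ (is_linear_scal_l e)). }
  exact (filterdiff_comp' g (fun k : R_NormedModule => scal k e) p lg _ Hg Hs).
Qed.

Lemma filterdiff_combination (U : V -> Prop) l p :
  Forall (fun ge => smooth U (fst ge)) l -> U p ->
  filterdiff (combination l) (locally p)
    (fun v => combination (map (fun ge => ((fun w => dirderiv (fst ge) w p), snd ge)) l) v).
Proof.
  intros Hl Hp. induction Hl as [|[g e] l Hg Hl IH].
  - apply (filterdiff_const zero).
  - apply (filterdiff_plus_fct (fun p => scal (g p) e) (combination l)); [| exact IH].
    apply (filterdiff_scal_vector g e p (fun v => dirderiv g v p)).
    apply ex_filterdiff_dirderiv, (smooth_ex_filterdiff U); assumption.
Qed.

Lemma filterdiff_smooth_map (U : V -> Prop) G p :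
  open U -> smooth_map U G -> U p -> ex_filterdiff G (locally p).
Proof.
  intros HU (l & Hl & HG) Hp. eexists.
  apply filterdiff_ext_locally with (2 := filterdiff_combination U l p Hl Hp).
  apply filter_imp with (2 := HU p Hp). intros y Hy. symmetry. apply HG, Hy.
Qed.

Lemma open_preimage (U : V -> Prop) (U' : W -> Prop) G :
  open U -> open U' -> smooth_map U G -> open (fun p => U p /\ U' (G p)).
Proof.
  intros HU HU' HG p [Hp HGp]. apply filter_and; [apply HU, Hp |].
  apply (filterdiff_continuous G p (filterdiff_smooth_map U G p HU HG Hp) U').
  apply HU', HGp.
Qed.

End Maps.

Lemma smooth_comp {V W : NormedModule R_AbsRing} (U : V -> Prop) (U' : W -> Prop)
    (G : V -> W) (f : W -> R) :
  open U -> open U' -> smooth_map U G -> smooth U' f ->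
  smooth (fun p => U p /\ U' (G p)) (fun p => f (G p)).
Proof.
  intros HU HU' HG Hf k. revert f Hf.
  pose proof (open_preimage U U' G HU HU' HG) as HO.
  induction k as [|k IH]; intros f Hf.
  - intros p [Hp HGp]. apply (continuous_comp G f).
    + apply filterdiff_continuous, (filterdiff_smooth_map U); assumption.
    + apply (smooth_continuous U'); assumption.
  - split.
    + intros p [Hp HGp].
      destruct (filterdiff_smooth_map U G p HU HG Hp) as [lG HlG].
      destruct (smooth_ex_filterdiff U' f _ Hf HGp) as [lf Hlf].
      eexists. apply (filterdiff_comp' G f); eassumption.
    + intros v. destruct HG as (l & Hl & HG).
      apply Ck_ext with (f := fun p => chain_sum l f v p (G p)); [exact HO | |].
      * intros p [Hp HGp]. symmetry.
        assert (HlG : filterdiff G (locally p)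
          (fun v => combination
            (map (fun ge => ((fun w => dirderiv (fst ge) w p), snd ge)) l) v)).
        { apply filterdiff_ext_locally with (2 := filterdiff_combination U l p Hl Hp).
          apply filter_imp with (2 := HU p Hp). intros y Hy. symmetry. apply HG, Hy. }
        pose proof (ex_filterdiff_dirderiv f _ (smooth_ex_filterdiff U' f _ Hf HGp)) as Hlf.
        rewrite (filterdiff_dirderiv _ _ _ v (filterdiff_comp' G f p _ _ HlG Hlf)).
        destruct Hlf as [Hlin _]. clear HlG Hl HG. cbn beta.
        induction l as [|[g e] l IHl]; cbn.
        -- pose proof (linear_plus _ Hlin zero zero) as H0. cbn beta in H0.
           rewrite plus_zero_l in H0. unfold plus in H0; cbn in H0. lra.
        -- rewrite (linear_plus _ Hlin), (linear_scal _ Hlin), IHl. reflexivity.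
      * clear HG. induction Hl as [|[g e] l Hg Hl IHl]; cbn.
        -- apply Ck_const, HO.
        -- apply Ck_plus; [exact HO | | exact IHl].
           apply Ck_mult; [exact HO | |].
           ++ apply Ck_subset with (U := U); [intros p []; assumption |].
              apply (smooth_dirderiv _ _ v Hg).
           ++ apply IH, smooth_dirderiv, Hf.
Qed.

Lemma smooth_map_real {V : NormedModule R_AbsRing} (U : V -> Prop) (f : V -> R) :
  smooth U f -> smooth_map (W := R_NormedModule) U f.
Proof.
  intros Hf. exists ((f, 1) :: nil). split.
  - constructor; [exact Hf | constructor].
  - intros p _. cbn. unfold plus, scal, zero; cbn. unfold mult; cbn. ring.
Qed.

Lemma smooth_map_pair {V W1 W2 : NormedModule R_AbsRing} (U : V -> Prop)
    (G1 : V -> W1) (G2 : V -> W2) :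
  smooth_map U G1 -> smooth_map U G2 ->
  smooth_map (W := prod_NormedModule R_AbsRing W1 W2) U (fun p => (G1 p, G2 p)).
Proof.
  intros (l1 & Hl1 & HG1) (l2 & Hl2 & HG2).
  exists (map (fun ge => (fst ge, (snd ge, zero))) l1 ++
          map (fun ge => (fst ge, (zero, snd ge))) l2).
  split.
  - apply Forall_app; split; apply Forall_map;
      [apply Forall_impl with (2 := Hl1) | apply Forall_impl with (2 := Hl2)]; auto.
  - intros p Hp. rewrite (HG1 p Hp), (HG2 p Hp). clear.
    induction l1 as [|[g e] l1 IH]; cbn.
    + induction l2 as [|[g e] l2 IH]; cbn; [reflexivity |].
      rewrite <- IH. apply injective_projections; cbn; [| reflexivity].
      rewrite plus_zero_r. symmetry. exact (scal_zero_r (K := R_AbsRing) (V := W1) (g p)).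
    + etransitivity; [| exact (f_equal (prod_plus (prod_scal (g p) (e, zero))) IH)].
      apply injective_projections; cbn; [reflexivity |].
      etransitivity; [symmetry; apply plus_zero_l |].
      apply (f_equal2 plus); [| reflexivity].
      symmetry. exact (scal_zero_r (K := R_AbsRing) (V := W2) (g p)).
Qed.

Lemma smooth_comp_on {V W : NormedModule R_AbsRing} (U : V -> Prop) (U' : W -> Prop)
    (G : V -> W) (f : W -> R) :
  open U -> open U' -> smooth_map U G -> (forall p, U p -> U' (G p)) -> smooth U' f ->
  smooth U (fun p => f (G p)).
Proof.
  intros HU HU' HG HGU Hf.
  apply smooth_subset with (2 := smooth_comp U U' G f HU HU' HG Hf). auto.
Qed.

(** * Partial derivatives and functions of one variable *)

Lemma Derive_shift (f : R -> R) (x : R) : Derive (fun h => f (x + h)) 0 = Derive f x.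
Proof.
  unfold Derive. f_equal. apply Lim_ext. intros h. do 3 f_equal; ring.
Qed.

Lemma is_derive_shift (f : R -> R) (x l : R) :
  is_derive f x l <-> is_derive (fun h => f (x + h)) 0 l.
Proof.
  split; intros H.
  - evar_last.
    + apply (is_derive_comp f (fun h => x + h)); [rewrite Rplus_0_r; exact H |].
      auto_derive; trivial.
    + apply Rmult_1_l.
  - apply is_derive_ext with (f := fun y => f (x + (y - x))).
    { intros t. f_equal; ring. }
    evar_last.
    + apply (is_derive_comp (fun h => f (x + h)) (fun y => y - x)).
      * replace (x - x) with 0 by ring. exact H.
      * auto_derive; trivial.
    + apply Rmult_1_l.
Qed.

Section Lines.
Context {V : NormedModule R_AbsRing}.
Implicit Types (U : V -> Prop) (f : V -> R) (p v w : V).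

(** Restricted to a line with direction [v], a directional derivative is an
    ordinary derivative, whether or not it exists. *)
Lemma dirderiv_line f v p (c : R -> V) (x : R) :
  (forall h : R, plus p (scal h v) = c (x + h)) ->
  dirderiv f v p = Derive (fun y => f (c y)) x.
Proof.
  intros Hc. rewrite <- Derive_shift. apply Derive_ext. intros h. f_equal. apply Hc.
Qed.

Lemma is_derive_line U f v p (c : R -> V) (x : R) :
  smooth U f -> U p -> (forall h : R, plus p (scal h v) = c (x + h)) ->
  is_derive (fun y => f (c y)) x (dirderiv f v p).
Proof.
  intros Hf Hp Hc. apply is_derive_shift.
  apply is_derive_ext with (f := fun h : R => f (plus p (scal h v))).
  { intros h. f_equal. apply Hc. }
  apply (filterdiff_is_derive_along f p (fun v => dirderiv f v p)).
  apply ex_filterdiff_dirderiv, (smooth_ex_filterdiff U); assumption.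
Qed.

Lemma scal_Rplus (a b : R) v : scal (a + b) v = plus (scal a v) (scal b v).
Proof. exact (scal_distr_r (K := R_AbsRing) a b v). Qed.

Lemma continuous_scal_vector {T : UniformSpace} (g : T -> R) v (t : T) :
  continuous g t -> continuous (fun t => scal (g t) v) t.
Proof.
  intros Hg. exact (continuous_scal (K := R_AbsRing) g (fun _ => v) t Hg (continuous_const v t)).
Qed.

(** Symmetry of second derivatives, by restriction to the plane spanned by [v]
    and [w] through [p]. *)
Lemma dirderiv_comm U f v w p :
  open U -> smooth U f -> U p ->
  dirderiv (dirderiv f v) w p = dirderiv (dirderiv f w) v p.
Proof.
  intros HU Hf Hp.
  set (c := fun x y : R => plus (plus p (scal x v)) (scal y w)).
  assert (Hcv : forall x y h, plus (c x y) (scal h v) = c (x + h) y).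
  { intros. unfold c. rewrite scal_Rplus, <- !plus_assoc. do 2 apply f_equal.
    apply plus_comm. }
  assert (Hcw : forall x y h, plus (c x y) (scal h w) = c x (y + h)).
  { intros. unfold c. rewrite scal_Rplus, <- !plus_assoc. reflexivity. }
  assert (Hc0 : c 0 0 = p) by (unfold c; rewrite !plus_scal_zero; reflexivity).
  assert (Hcc : forall z, continuous (fun z : R * R => c (fst z) (snd z)) z).
  { intros z. apply (continuous_plus (V := V)).
    - apply (continuous_plus (V := V)); [apply continuous_const |].
      apply continuous_scal_vector, continuous_fst.
    - apply continuous_scal_vector, continuous_snd. }
  assert (HUc : locally_2d (fun x y => U (c x y)) 0 0).
  { apply locally_2d_locally.
    apply (Hcc (0, 0) U). apply HU. cbn. rewrite Hc0. exact Hp. }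
  assert (Hv : forall f x y, Derive (fun z => f (c z y)) x = dirderiv f v (c x y)).
  { intros g x y. symmetry. apply (dirderiv_line g v (c x y) (fun z => c z y)). auto. }
  assert (Hw : forall f x y, Derive (fun z => f (c x z)) y = dirderiv f w (c x y)).
  { intros g x y. symmetry. apply (dirderiv_line g w (c x y) (c x)). auto. }
  assert (Hvw : forall x y, Derive (fun z => Derive (fun t => f (c z t)) y) x
                            = dirderiv (dirderiv f w) v (c x y)).
  { intros x y. rewrite <- Hv. apply Derive_ext. intros z. apply Hw. }
  assert (Hwv : forall x y, Derive (fun z => Derive (fun t => f (c t z)) x) y
                            = dirderiv (dirderiv f v) w (c x y)).
  { intros x y. rewrite <- Hw. apply Derive_ext. intros z. apply Hv. }
  assert (Hcont : forall g, smooth U g ->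
            continuity_2d_pt (fun x y => g (c x y)) 0 0).
  { intros g Hg. apply continuity_2d_pt_filterlim.
    apply (continuous_comp (fun z : R * R => c (fst z) (snd z)) g (0, 0)).
    - apply Hcc.
    - cbn. rewrite Hc0. apply (smooth_continuous U); assumption. }
  pose proof (smooth_dirderiv U f v Hf) as Hfv.
  pose proof (smooth_dirderiv U f w Hf) as Hfw.
  rewrite <- Hc0, <- Hwv, <- Hvw. symmetry.
  apply (Schwarz (fun x y => f (c x y))).
  - apply locally_2d_impl with (2 := HUc). apply locally_2d_forall.
    intros x y Hxy. repeat split.
    + eexists. apply (is_derive_line U f v (c x y) (fun z => c z y)); auto.
    + eexists. apply (is_derive_line U f w (c x y) (c x)); auto.
    + apply ex_derive_ext with (f := fun z => dirderiv f w (c z y)).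
      { intros z. symmetry. apply Hw. }
      eexists. apply (is_derive_line U _ v (c x y) (fun z => c z y)); auto.
    + apply ex_derive_ext with (f := fun z => dirderiv f v (c x z)).
      { intros z. symmetry. apply Hv. }
      eexists. apply (is_derive_line U _ w (c x y) (c x)); auto.
  - apply continuity_2d_pt_ext with (f := fun x y => dirderiv (dirderiv f w) v (c x y)).
    { intros. symmetry. apply Hvw. }
    apply Hcont, smooth_dirderiv, Hfw.
  - apply continuity_2d_pt_ext with (f := fun x y => dirderiv (dirderiv f v) w (c x y)).
    { intros. symmetry. apply Hwv. }
    apply Hcont, smooth_dirderiv, Hfv.
Qed.

End Lines.

Lemma dirderiv_one (f : R -> R) (x : R) : dirderiv (V := R_NormedModule) f 1 x = Derive f x.
Proof.
  apply (dirderiv_line (V := R_NormedModule) f 1 x (fun y => y)). intros h.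
  unfold plus, scal; cbn. unfold mult; cbn. ring.
Qed.

Lemma smooth_Derive (U : R -> Prop) (f : R -> R) :
  open U -> smooth U f -> smooth U (Derive f).
Proof.
  intros HU Hf. apply smooth_ext with (f := dirderiv (V := R_NormedModule) f 1);
    [exact HU | | apply smooth_dirderiv, Hf].
  intros p _. apply dirderiv_one.
Qed.

Lemma smooth_is_derive (U : R -> Prop) (f : R -> R) (x : R) :
  smooth U f -> U x -> is_derive f x (Derive f x).
Proof.
  intros Hf Hx. apply Derive_correct.
  destruct (smooth_ex_filterdiff U f x Hf Hx) as [l Hl].
  apply ex_derive_filterdiff. exists l. exact Hl.
Qed.

Lemma Ck_real k (U : R -> Prop) (f f' : R -> R) :
  open U -> (forall x, U x -> is_derive f x (f' x)) -> Ck (V := R_NormedModule) k U f' ->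
  Ck (V := R_NormedModule) (S k) U f.
Proof.
  intros HU Hf Hf'.
  split.
  - intros p Hp. exists (fun y => scal y (f' p)). exact (Hf p Hp).
  - intros v. apply Ck_ext with (f := fun x => v * f' x).
    + exact HU.
    + intros p Hp. symmetry.
      exact (filterdiff_dirderiv (V := R_NormedModule) f p
               (fun y => scal y (f' p)) v (Hf p Hp)).
    + apply Ck_mult; [exact HU | apply Ck_const, HU | exact Hf'].
Qed.

Lemma open_positive : open (fun x : R => 0 < x).
Proof. exact (open_gt 0). Qed.

Lemma smooth_Rinv : smooth (V := R_NormedModule) (fun x => 0 < x) Rinv.
Proof.
  intros k. induction k as [|k IH].
  - intros x Hx. apply (ex_derive_continuous Rinv). auto_derive. lra.
  - apply Ck_real with (f' := fun x => (-1) * (/ x * / x)); [exact open_positive | |].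
    + intros x Hx. auto_derive; [lra | field; lra].
    + pose proof open_positive. repeat apply Ck_mult; try apply Ck_const; assumption.
Qed.

Lemma smooth_ln : smooth (V := R_NormedModule) (fun x => 0 < x) ln.
Proof.
  intros k. apply Ck_pred. apply Ck_real with (f' := Rinv); [exact open_positive | |].
  - intros x Hx. apply is_derive_ln. exact Hx.
  - apply smooth_Rinv.
Qed.

Lemma smooth_comp_ln {V : NormedModule R_AbsRing} (U : V -> Prop) (f : V -> R) :
  open U -> smooth U f -> (forall p, U p -> 0 < f p) -> smooth U (fun p => ln (f p)).
Proof.
  intros HU Hf Hpos.
  apply (smooth_comp_on (W := R_NormedModule) U (fun x => 0 < x) f ln);
    [exact HU | exact open_positive | apply smooth_map_real, Hf | exact Hpos
    | exact smooth_ln].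
Qed.

Lemma smooth_smooth_on {V : NormedModule R_AbsRing} (A U : V -> Prop) (f : V -> R) :
  open U -> (forall p, A p -> U p) -> smooth U f -> smooth_on A f.
Proof. intros HU HA Hf. exists U. auto. Qed.

Lemma open_seg_interior (q : R * R) : open (fun x : R => fst q < x < snd q).
Proof. apply open_and; [exact (open_gt (fst q)) | exact (open_lt (snd q))]. Qed.

Lemma Derive_ext_open (U : R -> Prop) (f g : R -> R) (x : R) :
  open U -> (forall y, U y -> f y = g y) -> U x -> Derive f x = Derive g x.
Proof.
  intros HU Hfg Hx. apply Derive_ext_loc.
  apply filter_imp with (2 := HU x Hx). exact Hfg.
Qed.

Lemma Derive_n_2 (f : R -> R) (x : R) : Derive_n f 2 x = Derive (Derive f) x.
Proof. reflexivity. Qed.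

Lemma smooth_fst {W : NormedModule R_AbsRing} (U : R * W -> Prop) :
  open U -> smooth U (fst : R * W -> R).
Proof. intros HU. apply smooth_linear; [exact HU | exact is_linear_fst]. Qed.

Lemma smooth_comp_snd {W : NormedModule R_AbsRing} (U : R * W -> Prop) (l : W -> R) :
  open U -> is_linear l -> smooth U (fun p : R * W => l (snd p)).
Proof.
  intros HU Hl. apply smooth_linear; [exact HU |].
  exact (is_linear_comp _ _ is_linear_snd Hl).
Qed.

Ltac solve_line :=
  intros; repeat apply injective_projections; cbn;
  unfold plus, scal, zero; cbn; unfold mult; cbn; ring.

(** * Integrals depending on parameters *)

(** The tube lemma around a compact segment, which also gives some room beyond
    its endpoints. *)
Lemma tube {T : UniformSpace} (a b : R) (p0 : T) (Q : R * T -> Prop) :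
  a <= b -> (forall x, a <= x <= b -> locally (x, p0) Q) ->
  exists d : posreal, forall x p, a - d <= x <= b + d -> ball p0 d p -> Q (x, p).
Proof.
  intros Hab HQ.
  assert (Hd : forall t, exists d : posreal, a <= t <= b ->
            forall y, ball (t, p0) (2 * d) y -> Q y).
  { intros t. destruct (classic (a <= t <= b)) as [Ht | Ht].
    - destruct (HQ t Ht) as [d Hd]. exists (pos_div_2 d). intros _ y Hy.
      apply Hd. replace (pos d) with (2 * pos_div_2 d) by (cbn; field). exact Hy.
    - exists (mkposreal 1 Rlt_0_1). tauto. }
  set (delta := fun t => proj1_sig (constructive_indefinite_description _ (Hd t))).
  assert (Hdelta : forall t, a <= t <= b ->
            forall y, ball (t, p0) (2 * delta t) y -> Q y).
  { intros t. unfold delta. destruct constructive_indefinite_description; assumption. }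
  destruct (compactness_value_1d a b delta) as [d Hcd].
  exists (pos_div_2 d). intros x p Hx Hp. cbn in Hx. pose proof (cond_pos d).
  set (x' := Rmax a (Rmin b x)).
  assert (Hx' : a <= x' <= b /\ Rabs (x - x') <= d / 2).
  { unfold x', Rmax, Rmin. destruct (Rle_dec b x); destruct Rle_dec; split; try lra;
      apply Rabs_le; lra. }
  destruct Hx' as [Hx' Hxx']. apply NNPP. intros HnQ.
  apply (Hcd x' Hx'). intros (t & Ht & Hxt & Hdt). apply HnQ, (Hdelta t Ht). split.
  - change (Rabs (x - t) < 2 * delta t).
    replace (x - t) with ((x - x') + (x' - t)) by ring.
    apply Rle_lt_trans with (1 := Rabs_triang _ _). cbn in *. lra.
  - apply (@ball_le T p0 (pos_div_2 d)); [cbn; lra | exact Hp].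
Qed.

Lemma tube_locally {T : UniformSpace} (a b : R) (p0 : T) (Q : R * T -> Prop) :
  a <= b -> (forall x, a <= x <= b -> locally (x, p0) Q) ->
  locally p0 (fun p => forall x, a <= x <= b -> Q (x, p)).
Proof.
  intros Hab HQ. destruct (tube a b p0 Q Hab HQ) as [d Hd].
  exists d. intros p Hp x Hx. apply Hd; [| exact Hp].
  pose proof (cond_pos d). lra.
Qed.

Section Integral.
Context {V : NormedModule R_AbsRing}.
Notation RV := (prod_NormedModule R_AbsRing R_NormedModule V).

Lemma continuous_pair {T U1 U2 : UniformSpace} (f : T -> U1) (g : T -> U2) (t : T) :
  continuous f t -> continuous g t -> continuous (fun t => (f t, g t)) t.
Proof.
  intros Hf Hg. apply (continuous_comp_2 f g (fun u v => (u, v)) t Hf Hg).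
  apply continuous_ext with (f := fun z => z); [intros []; reflexivity |].
  apply continuous_id.
Qed.

Lemma continuous_line (p v : V) (z : R * R) :
  continuous (fun z : R * R => (snd z, plus p (scal (fst z) v)) : RV) z.
Proof.
  apply (continuous_pair (U1 := R_UniformSpace) (U2 := V)).
  - apply continuous_snd.
  - apply (continuous_plus (V := V)); [apply continuous_const |].
    apply continuous_scal_vector, continuous_fst.
Qed.

Lemma smooth_slice_continuous (U : RV -> Prop) (G : RV -> R) x p :
  smooth U G -> U (x, p) -> continuous (fun x : R => G (x, p)) x.
Proof.
  intros HG Hx. apply (continuous_comp (fun x : R => (x, p) : RV) G).
  - apply (continuous_pair (U1 := R_UniformSpace) (U2 := V));
      [apply continuous_id | apply continuous_const].
  - apply (smooth_continuous U); assumption.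
Qed.

Lemma smooth_ex_RInt (U : RV -> Prop) (G : RV -> R) a b p :
  smooth U G -> (forall x, Rmin a b <= x <= Rmax a b -> U (x, p)) ->
  ex_RInt (fun x : R => G (x, p)) a b.
Proof.
  intros HG Hx. apply (ex_RInt_continuous (V := R_CompleteNormedModule)). intros x Hab.
  apply (smooth_slice_continuous U G x p HG), Hx, Hab.
Qed.

(** Differentiation under the integral sign, the endpoints of the interval
    moving together with the parameter. *)
Lemma is_derive_RInt_line (U : RV -> Prop) (G : RV -> R) (al be : R -> R)
    (da db : R) (p v : V) :
  open U -> smooth U G -> al 0 <= be 0 ->
  (forall x, al 0 <= x <= be 0 -> U (x, p)) ->
  is_derive al 0 da -> is_derive be 0 db ->
  is_derive (fun h : R => RInt (fun x : R => G (x, plus p (scal h v))) (al h) (be h)) 0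
    (RInt (fun x : R => dirderiv G (zero, v) (x, p)) (al 0) (be 0)
     + - G (al 0, p) * da + G (be 0, p) * db).
Proof.
  intros HU HG Hab HUp Hal Hbe.
  set (z h x := (x, plus p (scal h v)) : RV).
  assert (Hz0 : forall x, z 0 x = (x, p)).
  { intros x. unfold z. rewrite plus_scal_zero. reflexivity. }
  destruct (tube (T := R_UniformSpace) (al 0) (be 0) 0 (fun y => U (z (snd y) (fst y))))
    as [d Hd]; [exact Hab | |].
  { intros x Hx.
    apply (continuous_comp (fun y : R * R => (snd y, fst y))
             (fun y : R * R => z (fst y) (snd y) : RV) (x, 0)).
    - apply (continuous_pair (T := prod_UniformSpace R_UniformSpace R_UniformSpace)
               (U1 := R_UniformSpace) (U2 := R_UniformSpace));
        [apply continuous_snd | apply continuous_fst].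
    - apply continuous_line.
    - cbn. apply HU. rewrite Hz0. apply HUp, Hx. }
  pose proof (cond_pos d) as Hd0.
  assert (HU2 : forall h x, Rabs h < d -> al 0 - d <= x <= be 0 + d -> U (z h x)).
  { intros h x Hh Hx. apply (Hd x h Hx). change (Rabs (h - 0) < d).
    rewrite Rminus_0_r. exact Hh. }
  assert (Hloc : forall Q : R -> Prop, (forall h, Rabs h < d -> Q h) -> locally 0 Q).
  { intros Q HQ. exists d. intros h Hh. apply HQ.
    change (Rabs (h - 0) < d) in Hh. rewrite Rminus_0_r in Hh. exact Hh. }
  assert (Hline : forall h x k,
    plus (z h x) (scal k ((zero, v) : RV)) = z (h + k) x).
  { intros h x k. unfold z. rewrite scal_Rplus, plus_assoc.
    apply injective_projections; cbn; [| reflexivity].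
    unfold plus, scal, zero; cbn; unfold mult; cbn; ring. }
  assert (HD : forall h x, Derive (fun u => G (z u x)) h = dirderiv G (zero, v) (z h x)).
  { intros h x. symmetry. apply (dirderiv_line G _ _ (fun u => z u x)). auto. }
  pose proof (smooth_dirderiv U G (zero, v) HG) as HdG.
  assert (Hcont : forall h x, U (z h x) ->
    continuity_2d_pt (fun u y => Derive (fun t => G (z t y)) u) h x).
  { intros h x Hx.
    apply continuity_2d_pt_ext with (f := fun u y => dirderiv G (zero, v) (z u y)).
    { intros. symmetry. apply HD. }
    apply continuity_2d_pt_filterlim.
    apply (continuous_comp (fun y : R * R => z (fst y) (snd y) : RV)
             (dirderiv G (zero, v)) (h, x)).
    - apply continuous_line.
    - apply (smooth_continuous U); assumption. }
  assert (Hcont' : forall x, al 0 - d < x < be 0 + d ->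
    locally_2d (fun x' t => continuity_2d_pt (fun u y => Derive (fun t => G (z t y)) u) x' t)
      0 x).
  { intros x Hx.
    assert (He : 0 < Rmin d (Rmin (x - (al 0 - d)) (be 0 + d - x))).
    { repeat apply Rmin_glb_lt; lra. }
    exists (mkposreal _ He). cbn. intros h y Hh Hy. apply Hcont, HU2.
    - rewrite Rminus_0_r in Hh. apply Rlt_le_trans with (1 := Hh), Rmin_l.
    - apply Rabs_lt_between in Hy.
      pose proof (Rmin_r d (Rmin (x - (al 0 - d)) (be 0 + d - x))).
      pose proof (Rmin_l (x - (al 0 - d)) (be 0 + d - x)).
      pose proof (Rmin_r (x - (al 0 - d)) (be 0 + d - x)). lra. }
  assert (Hex : forall h c e, Rabs h < d -> al 0 - d <= c -> c <= e -> e <= be 0 + d ->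
    ex_RInt (fun t => G (z h t)) c e).
  { intros h c e Hh Hc Hce He. apply (smooth_ex_RInt U); [exact HG |].
    intros x. rewrite Rmin_left, Rmax_right by exact Hce. intros Hx.
    apply (HU2 h); [exact Hh | lra]. }
  assert (Hc0 : forall x, al 0 <= x <= be 0 -> continuity_pt (fun t => G (z 0 t)) x).
  { intros x Hx. apply continuity_pt_filterlim.
    apply (smooth_slice_continuous U G x _ HG), (HU2 0); [rewrite Rabs_R0; exact Hd0 | lra]. }
  assert (Hd2 : d / 2 < d) by lra.
  evar_last.
  - apply (is_derive_RInt_param_bound_comp (fun h x => G (z h x)) al be 0 da db).
    + apply Hloc. intros h Hh. apply Hex; lra.
    + exists d. apply Hloc. intros h Hh. apply Hex; lra.
    + exists d. apply Hloc. intros h Hh. apply Hex; lra.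
    + exact Hal.
    + exact Hbe.
    + exists d. apply Hloc. intros h Hh x Hx. eexists.
      apply (is_derive_line U G (zero, v) (z h x) (fun u => z u x) h HG); [| auto].
      rewrite Rmin_left, Rmax_right in Hx by lra. apply HU2; assumption.
    + rewrite Rmin_left, Rmax_right by lra. intros x Hx. apply Hcont, HU2;
        [rewrite Rabs_R0; exact Hd0 | lra].
    + apply Hcont'. lra.
    + apply Hcont'. lra.
    + apply Hc0. lra.
    + apply Hc0. lra.
  - rewrite !Hz0. do 2 apply f_equal2; try reflexivity.
    apply RInt_ext. intros x _. rewrite HD, Hz0. reflexivity.
Qed.

Lemma is_derive_RInt_fixed (U : RV -> Prop) (G : RV -> R) (a b : R) (p v : V) :
  open U -> smooth U G -> a <= b -> (forall x, a <= x <= b -> U (x, p)) ->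
  is_derive (fun h : R => RInt (fun x : R => G (x, plus p (scal h v))) a b) 0
    (RInt (fun x : R => dirderiv G (zero, v) (x, p)) a b).
Proof.
  intros HU HG Hab HUp. evar_last.
  - apply (is_derive_RInt_line U G (fun _ => a) (fun _ => b) 0 0 p v HU HG Hab HUp);
      apply @is_derive_const.
  - cbn. ring.
Qed.

Lemma continuous_RInt_param (U : RV -> Prop) (G : RV -> R) (a b : R) (p : V) :
  open U -> smooth U G -> a <= b -> (forall x, a <= x <= b -> U (x, p)) ->
  continuous (fun q : V => RInt (fun x : R => G (x, q)) a b) p.
Proof.
  intros HU HG Hab HUp. apply filterlim_locally. intros eps.
  assert (He : 0 < eps / (2 * (b - a + 1))).
  { apply Rdiv_lt_0_compat; [apply cond_pos | lra]. }
  set (e := mkposreal _ He).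
  assert (Hnear : locally p (fun q => forall x, a <= x <= b ->
            U (x, q) /\ Rabs (G (x, q) - G (x, p)) < 2 * e)).
  { apply (tube_locally a b p (fun y : RV => U y /\ Rabs (G y - G (fst y, p)) < 2 * e) Hab).
    intros x Hx. apply filter_and; [apply HU, HUp, Hx |].
    pose proof (smooth_continuous U G (x, p) HG (HUp x Hx)) as Hc.
    assert (Hc' : continuous (fun y : RV => G (fst y, p)) (x, p)).
    { apply (continuous_comp (fun y : RV => (fst y, p) : RV) G).
      - apply (continuous_pair (T := RV) (U1 := R_UniformSpace) (U2 := V));
          [apply continuous_fst | apply continuous_const].
      - exact Hc. }
    pose proof (proj1 (filterlim_locally _ _) Hc e) as H1.
    pose proof (proj1 (filterlim_locally _ _) Hc' e) as H2.
    generalize (filter_and _ _ H1 H2). apply filter_imp. intros y [Hy1 Hy2].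
    change (Rabs (G y - G (x, p)) < e) in Hy1.
    change (Rabs (G (fst y, p) - G (x, p)) < e) in Hy2.
    replace (G y - G (fst y, p)) with ((G y - G (x, p)) - (G (fst y, p) - G (x, p))) by ring.
    apply Rle_lt_trans with (1 := Rabs_triang _ _). rewrite Rabs_Ropp. lra. }
  generalize Hnear. apply filter_imp. intros q Hq.
  change (Rabs (RInt (fun x => G (x, q)) a b - RInt (fun x => G (x, p)) a b) < eps).
  assert (Hexp : ex_RInt (fun x => G (x, p)) a b).
  { apply (smooth_ex_RInt U); [exact HG |]. rewrite Rmin_left, Rmax_right by exact Hab.
    exact HUp. }
  assert (Hexq : ex_RInt (fun x => G (x, q)) a b).
  { apply (smooth_ex_RInt U); [exact HG |]. rewrite Rmin_left, Rmax_right by exact Hab.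
    apply Hq. }
  change (Rabs (minus (RInt (fun x => G (x, q)) a b) (RInt (fun x => G (x, p)) a b)) < eps).
  rewrite <- RInt_minus by assumption.
  apply Rle_lt_trans with ((b - a) * (2 * e)).
  - apply abs_RInt_le_const; [exact Hab | apply @ex_RInt_minus; assumption |].
    intros x Hx. apply Rlt_le, Hq, Hx.
  - cbn. pose proof (cond_pos eps).
    replace ((b - a) * (2 * (eps / (2 * (b - a + 1))))) with (eps * ((b - a) / (b - a + 1)))
      by (field; lra).
    rewrite <- (Rmult_1_r eps) at 2. apply Rmult_lt_compat_l; [assumption |].
    apply Rlt_div_l; lra.
Qed.

End Integral.

Lemma ex_RInt_smooth_real (U : R -> Prop) (f : R -> R) (a b : R) :
  a <= b -> (forall x, a <= x <= b -> U x) -> smooth U f -> ex_RInt f a b.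
Proof.
  intros Hab HU Hf. apply (ex_RInt_continuous (V := R_CompleteNormedModule)).
  rewrite Rmin_left, Rmax_right by exact Hab. intros x Hx.
  apply (smooth_continuous U f x Hf), HU, Hx.
Qed.

Lemma open_P : open P.
Proof.
  intros [a b] Hab. unfold P in Hab; cbn in Hab.
  assert (Hd : 0 < (b - a) / 2) by lra.
  exists (mkposreal _ Hd). intros [a' b'] [Ha Hb]. unfold P; cbn in *.
  change (Rabs (a' - a) < (b - a) / 2) in Ha. change (Rabs (b' - b) < (b - a) / 2) in Hb.
  apply Rabs_lt_between in Ha. apply Rabs_lt_between in Hb. lra.
Qed.

(** The parameters range over a plane, so that continuity of the two partial
    derivatives gives differentiability. *)
Lemma smooth_RInt_fixed (Q : R * R -> Prop) (U : R * (R * R) -> Prop) (a b : R) :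
  open Q -> open U -> a <= b ->
  (forall x q, a <= x <= b -> Q q -> U (x, q)) ->
  forall G, smooth U G -> smooth Q (fun q => RInt (fun x => G (x, q)) a b).
Proof.
  intros HQ HU Hab HQU G HG k. revert G HG. induction k as [|k IH]; intros G HG.
  - intros q Hq. apply (continuous_RInt_param U G); auto.
  - set (K := fun (G : R * (R * R) -> R) q => RInt (fun x => G (x, q)) a b).
    assert (HK : forall v q, Q q ->
      is_derive (fun h : R => K G (plus q (scal h v))) 0 (K (dirderiv G (zero, v)) q)).
    { intros v q Hq. apply (is_derive_RInt_fixed U G a b q v); auto. }
    assert (Hc : forall v q, Q q -> continuous (K (dirderiv G (zero, v))) q).
    { intros v q Hq. apply (continuous_RInt_param U); auto. apply smooth_dirderiv, HG. }
    split.
    + intros [x y] Hq. eexists.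
      apply filterdiff_ext with (f := fun u : R * R => K G (fst u, snd u)).
      { intros []; reflexivity. }
      apply (is_derive_filterdiff (fun x y => K G (x, y)) x y
               (fun x y => K (dirderiv G (zero, (1, 0))) (x, y))
               (K (dirderiv G (zero, (0, 1))) (x, y))).
      * apply filter_imp with (2 := HQ (x, y) Hq). intros [x' y'] Hq'.
        apply is_derive_shift.
        apply is_derive_ext with (2 := HK (1, 0) (x', y') Hq').
        intros h. f_equal. apply injective_projections; cbn;
          unfold plus, scal; cbn; unfold mult; cbn; ring.
      * apply is_derive_shift.
        apply is_derive_ext with (2 := HK (0, 1) (x, y) Hq).
        intros h. f_equal. apply injective_projections; cbn;
          unfold plus, scal; cbn; unfold mult; cbn; ring.
      * apply continuous_ext with (f := K (dirderiv G (zero, (1, 0)))).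
        { intros []; reflexivity. }
        apply Hc, Hq.
    + intros v. apply Ck_ext with (f := K (dirderiv G (zero, v))).
      * exact HQ.
      * intros q Hq. symmetry. apply is_derive_unique, HK, Hq.
      * apply IH, smooth_dirderiv, HG.
Qed.

Lemma smooth_RInt_fibers (U : R * (R * R) -> Prop) (F : R * (R * R) -> R) :
  open U -> (forall p, fibers p -> U p) -> smooth U F ->
  smooth P (fun q => RInt (fun x => F (x, q)) (fst q) (snd q)).
Proof.
  intros HU HfU HF.
  (* The substitution [x = a + s (b - a)] fixes the interval of integration. *)
  set (T := fun _ : R * (R * R) => True).
  assert (HT : open T) by apply open_true.
  set (m := fun p : R * (R * R) =>
              ((snd (snd p) - fst (snd p)) * fst p + fst (snd p),
               (fst (snd p), snd (snd p)))).
  pose proof (smooth_comp_snd T fst HT is_linear_fst) as Ha.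
  pose proof (smooth_comp_snd T snd HT is_linear_snd) as Hb.
  assert (Hm : smooth_map (V := prod_NormedModule R_AbsRing R_NormedModule _)
                 (W := prod_NormedModule R_AbsRing R_NormedModule
                         (prod_NormedModule R_AbsRing R_NormedModule R_NormedModule)) T m).
  { apply smooth_map_pair; [| apply smooth_map_pair]; apply smooth_map_real; [| assumption..].
    apply smooth_plus; [assumption | | assumption].
    apply smooth_mult; [assumption | | apply smooth_fst, HT].
    apply smooth_minus; assumption. }
  pose proof (smooth_comp T U m F HT HU Hm HF) as HFm.
  pose proof (open_preimage T U m HT HU Hm) as HO.
  set (G := fun p : R * (R * R) => (snd (snd p) - fst (snd p)) * F (m p)).
  assert (HG : smooth (fun p : R * (R * R) => T p /\ U (m p)) G).
  { apply smooth_mult; [exact HO | | exact HFm].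
    apply smooth_subset with (U := T); [intros p _; exact I |].
    apply smooth_minus; assumption. }
  assert (Hin : forall (s : R) (q : R * R), 0 <= s <= 1 -> P q ->
                  T (s, q) /\ U (m (s, q))).
  { intros s [a b] Hs Hq. split; [exact I |]. apply HfU. unfold P in Hq; cbn in Hq.
    unfold fibers, seg, m, P; cbn. repeat split; [exact Hq | nra | nra]. }
  apply smooth_ext with (f := fun q => RInt (fun s => G (s, q)) 0 1).
  - exact open_P.
  - intros [a b]. revert a b. refine (fun (a b : R) Hq => _). cbn.
    etransitivity; [apply (RInt_comp_lin (V := R_CompleteNormedModule)
                             (fun x => F (x, (a, b))) (b - a) a 0 1) |].
    + apply (smooth_ex_RInt U); [exact HF |].
      replace ((b - a) * 0 + a) with a by ring. replace ((b - a) * 1 + a) with b by ring.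
      unfold P in Hq; cbn in Hq. rewrite Rmin_left, Rmax_right by lra.
      intros x Hx. apply HfU. repeat split; cbn; tauto.
    + replace ((b - a) * 0 + a) with a by ring. replace ((b - a) * 1 + a) with b by ring.
      reflexivity.
  - exact (smooth_RInt_fixed P _ 0 1 open_P HO Rle_0_1 Hin G HG).
Qed.

(** * The groupoid cocycle *)

(** At every point of a segment, endpoints included, the derivative of a
    function that is nondecreasing on the segment is nonnegative. *)
Lemma is_derive_nondecreasing (f : R -> R) (a b x l : R) :
  a < b -> a <= x <= b ->
  (forall y z, a <= y -> y <= z -> z <= b -> f y <= f z) ->
  is_derive f x l -> 0 <= l.
Proof.
  intros Hab Hx Hf Hl%is_derive_Reals. apply Rnot_lt_le. intros Hneg.
  assert (He : 0 < - l) by lra.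
  destruct (Hl _ He) as [d Hd]. pose proof (cond_pos d).
  set (e := Rmin d (b - a) / 2).
  assert (He' : 0 < Rmin d (b - a)) by (apply Rmin_glb_lt; lra).
  assert (Hed : 0 < e /\ e < d /\ e <= (b - a) / 2).
  { unfold e. pose proof (Rmin_l d (b - a)). pose proof (Rmin_r d (b - a)). lra. }
  assert (Hh : exists h, h <> 0 /\ Rabs h < d /\ 0 <= (f (x + h) - f x) / h).
  { destruct (Rle_dec x ((a + b) / 2)) as [Hm | Hm].
    - exists e. repeat split; [lra | rewrite Rabs_pos_eq; lra |].
      assert (f x <= f (x + e)) by (apply Hf; lra).
      apply Rdiv_le_0_compat; lra.
    - exists (- e). repeat split; [lra | rewrite Rabs_Ropp, Rabs_pos_eq; lra |].
      assert (f (x + - e) <= f x) by (apply Hf; lra).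
      replace ((f (x + - e) - f x) / - e) with ((f x - f (x + - e)) / e) by (field; lra).
      apply Rdiv_le_0_compat; lra. }
  destruct Hh as (h & Hh0 & Hhd & Hq). specialize (Hd h Hh0 Hhd).
  apply Rabs_lt_between in Hd. lra.
Qed.

Lemma is_derive_segment_unique (f g : R -> R) (a b x l m : R) :
  a < b -> a <= x <= b -> (forall y, a <= y <= b -> f y = g y) ->
  is_derive f x l -> is_derive g x m -> l = m.
Proof.
  intros Hab Hx Hfg Hf Hg. apply Rle_antisym.
  - assert (0 <= m - l); [| lra].
    apply (is_derive_nondecreasing (fun y => g y - f y) a b x); try assumption.
    + intros y z Hy Hyz Hz. rewrite (Hfg y), (Hfg z); lra.
    + apply (is_derive_minus g f); assumption.
  - assert (0 <= l - m); [| lra].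
    apply (is_derive_nondecreasing (fun y => f y - g y) a b x); try assumption.
    + intros y z Hy Hyz Hz. rewrite (Hfg y), (Hfg z); lra.
    + apply (is_derive_minus f g); assumption.
Qed.

Lemma bdiff_maps (g : arrow) (x : R) :
  is_bdiff g -> seg (src g) x -> seg (trg g) (fn g x).
Proof.
  intros (HP & _ & Hmono & _) Hx. unfold P in HP. unfold seg, trg in *; cbn.
  split.
  - destruct (proj1 Hx) as [Hlt | <-]; [| apply Rle_refl].
    apply Rlt_le, Hmono; unfold seg; lra.
  - destruct (proj2 Hx) as [Hlt | ->]; [| apply Rle_refl].
    apply Rlt_le, Hmono; unfold seg; lra.
Qed.

Lemma bdiff_maps_interior (g : arrow) (x : R) :
  is_bdiff g -> fst (src g) < x < snd (src g) ->
  fst (trg g) < fn g x < snd (trg g).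
Proof.
  intros (HP & _ & Hmono & _) Hx. unfold P in HP. unfold trg; cbn.
  split; apply Hmono; unfold seg; lra.
Qed.

Lemma P_trg (g : arrow) : is_bdiff g -> P (trg g).
Proof.
  intros (HP & _ & Hmono & _). unfold P in *; cbn. apply Hmono; unfold seg; lra.
Qed.

(** Differentiating [k o fn g = id] on the segment, endpoints included, shows that
    the derivative does not vanish. *)
Lemma bdiff_Derive_pos (g : arrow) (x : R) :
  is_bdiff g -> seg (src g) x -> 0 < Derive (fn g) x.
Proof.
  intros Hg Hx. pose proof (bdiff_maps g x Hg Hx) as Hgx.
  destruct Hg as (HP & (U & HU & HsU & HgU) & Hmono & k & (Uk & HUk & HsUk & HkU) & Hk & _).
  pose proof (smooth_is_derive U (fn g) x HgU (HsU x Hx)) as Dg.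
  pose proof (smooth_is_derive Uk k (fn g x) HkU (HsUk _ Hgx)) as Dk.
  unfold P in HP.
  assert (H1 : Derive (fn g) x * Derive k (fn g x) = 1).
  { apply (is_derive_segment_unique (fun y => k (fn g y)) (fun y => y)
             (fst (src g)) (snd (src g)) x); [exact HP | exact Hx | exact Hk | |].
    - apply (is_derive_comp k (fn g)); assumption.
    - apply @is_derive_id. }
  assert (H0 : 0 <= Derive (fn g) x).
  { apply (is_derive_nondecreasing (fn g) (fst (src g)) (snd (src g)) x);
      [exact HP | exact Hx | | exact Dg].
    intros y z Hy [Hyz | ->] Hz; [| apply Rle_refl].
    apply Rlt_le, Hmono; unfold seg; lra. }
  destruct H0 as [H0 | H0]; [exact H0 |]. rewrite <- H0, Rmult_0_l in H1. lra.
Qed.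

Lemma open_Derive_pos (U : R -> Prop) (f : R -> R) :
  open U -> smooth U f -> open (fun x => U x /\ 0 < Derive f x).
Proof.
  intros HU Hf.
  apply (open_preimage (V := R_NormedModule) (W := R_NormedModule) U (fun y => 0 < y) (Derive f));
    [exact HU | exact open_positive | apply smooth_map_real, smooth_Derive; assumption].
Qed.

(** The logarithm of the derivative, from which [chi] is built. *)
Definition logd (f : R -> R) (x : R) : R := ln (Derive f x).

(** [U] is a neighbourhood of the segment of [g] on which [g] is represented by a
    smooth function with positive derivative. *)
Definition good_nbhd (g : arrow) (U : R -> Prop) : Prop :=
  open U /\ (forall x, seg (src g) x -> U x) /\ smooth U (fn g) /\
  (forall x, U x -> 0 < Derive (fn g) x).

Lemma bdiff_good_nbhd (g : arrow) : is_bdiff g -> exists U, good_nbhd g U.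
Proof.
  intros Hg. pose proof Hg as (_ & (U & HU & HsU & HgU) & _).
  exists (fun x => U x /\ 0 < Derive (fn g) x). split; [| split; [| split]].
  - apply open_Derive_pos; assumption.
  - intros x Hx. split; [apply HsU, Hx | apply bdiff_Derive_pos; assumption].
  - apply smooth_subset with (2 := HgU). tauto.
  - tauto.
Qed.

Lemma smooth_logd (U : R -> Prop) (f : R -> R) :
  open U -> smooth U f -> (forall x, U x -> 0 < Derive f x) -> smooth U (logd f).
Proof.
  intros HU Hf Hpos. apply smooth_comp_ln; [exact HU | | exact Hpos].
  apply smooth_Derive; assumption.
Qed.

Lemma chi_logd (g h : arrow) :
  chi g h = RInt (fun x => logd (fn g) (fn h x) * Derive (logd (fn h)) x)
              (fst (src h)) (snd (src h)).
Proof. reflexivity. Qed.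

Lemma smooth_comp_real (U U' : R -> Prop) (f g : R -> R) :
  open U -> open U' -> smooth U g -> smooth U' f ->
  smooth (fun x => U x /\ U' (g x)) (fun x => f (g x)).
Proof.
  intros HU HU' Hg Hf.
  apply (smooth_comp (V := R_NormedModule) (W := R_NormedModule) U U' g f);
    [exact HU | exact HU' | apply smooth_map_real, Hg | exact Hf].
Qed.

Lemma open_preimage_real (U U' : R -> Prop) (g : R -> R) :
  open U -> open U' -> smooth U g -> open (fun x => U x /\ U' (g x)).
Proof.
  intros HU HU' Hg.
  apply (open_preimage (V := R_NormedModule) (W := R_NormedModule) U U' g);
    [exact HU | exact HU' | apply smooth_map_real, Hg].
Qed.

(** [chi] only sees the restrictions to the segments: the integral is over the
    interior, which [h] maps into the interior of the segment of [g]. *)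
Lemma chi_arrow_eq (g g' h h' : arrow) :
  is_bdiff h -> arrow_eq g g' -> arrow_eq h h' -> composable g h -> chi g h = chi g' h'.
Proof.
  intros Hh [Hsg Hg] [Hsh Hh'] Hc. rewrite !chi_logd, <- Hsh.
  pose proof Hh as (HP & _). unfold P in HP.
  apply RInt_ext. rewrite Rmin_left, Rmax_right by lra. intros x Hx.
  set (I := fun x => fst (src h) < x < snd (src h)).
  assert (HI : open I) by apply open_seg_interior.
  assert (ED : forall y, I y -> logd (fn h) y = logd (fn h') y).
  { intros y Hy. unfold logd. f_equal.
    apply (Derive_ext_open I); [exact HI | | exact Hy].
    intros z Hz. apply Hh'. unfold I in Hz. unfold seg. lra. }
  rewrite (Derive_ext_open I _ _ x HI ED Hx).
  rewrite <- (Hh' x) by (unfold seg; lra). f_equal. unfold logd. f_equal.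
  apply (Derive_ext_open (fun y => fst (src g) < y < snd (src g)));
    [apply open_seg_interior | |].
  - intros z Hz. apply Hg. unfold seg. lra.
  - rewrite Hc. apply bdiff_maps_interior; assumption.
Qed.

(** The chain rule for the logarithm of the derivative. *)
Lemma logd_comp (Ug Uh : R -> Prop) (g h : R -> R) (x : R) :
  smooth Ug g -> smooth Uh h -> Uh x -> Ug (h x) ->
  0 < Derive g (h x) -> 0 < Derive h x ->
  logd (fun x => g (h x)) x = logd g (h x) + logd h x.
Proof.
  intros Hg Hh Hx Hhx Hpg Hph. unfold logd.
  rewrite Derive_comp, Rmult_comm, ln_mult by
    (assumption || (eexists; eapply smooth_is_derive; eassumption)).
  reflexivity.
Qed.

Lemma chi_cocycle_identity (g h k : arrow) :
  is_bdiff g -> is_bdiff h -> is_bdiff k -> composable g h -> composable h k ->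
  chi g (comp h k) + chi h k = chi (comp g h) k + chi g h.
Proof.
  intros Bg Bh Bk Cgh Chk. unfold composable in *.
  destruct (bdiff_good_nbhd g Bg) as (Ug & HUg & Sg & Hg & Pg).
  destruct (bdiff_good_nbhd h Bh) as (Uh & HUh & Sh & Hh & Ph).
  destruct (bdiff_good_nbhd k Bk) as (Uk & HUk & Sk & Hk & Pk).
  set (a := fst (src k)). set (b := snd (src k)).
  assert (Hab : a < b) by exact (proj1 Bk).
  set (Ugh := fun y => Uh y /\ Ug (fn h y)).
  assert (HUgh : open Ugh) by (apply open_preimage_real; assumption).
  set (U := fun x => Uk x /\ Ugh (fn k x)).
  assert (HU : open U) by (apply open_preimage_real; assumption).
  assert (HsU : forall x, a <= x <= b -> U x).
  { intros x Hx.
    assert (Hkx : seg (src h) (fn k x)) by (rewrite Chk; apply bdiff_maps; assumption).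
    repeat split; [apply Sk, Hx | apply Sh, Hkx | apply Sg].
    rewrite Cgh. apply bdiff_maps; assumption. }
  set (Lg := logd (fn g)). set (Lh := logd (fn h)). set (Lk := logd (fn k)).
  assert (HLg : smooth Ug Lg) by (apply smooth_logd; assumption).
  assert (HLh : smooth Uh Lh) by (apply smooth_logd; assumption).
  assert (HLk : smooth U Lk).
  { apply smooth_subset with (U := Uk); [unfold U; tauto | apply smooth_logd; assumption]. }
  assert (HLgh : smooth Ugh (fun y => Lg (fn h y))) by (apply smooth_comp_real; assumption).
  assert (HLghk : smooth U (fun x => Lg (fn h (fn k x)))).
  { apply (smooth_comp_real Uk Ugh (fun y => Lg (fn h y))); assumption. }
  assert (HLh' : smooth Ugh Lh) by (apply smooth_subset with (2 := HLh); unfold Ugh; tauto).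
  assert (HLhk : smooth U (fun x => Lh (fn k x))) by (apply smooth_comp_real; assumption).
  assert (HDLk : smooth U (Derive Lk)) by (apply smooth_Derive; assumption).
  assert (HDLhk : smooth U (Derive (fun x => Lh (fn k x)))) by (apply smooth_Derive; assumption).
  assert (Hex : forall f, smooth U f -> ex_RInt f a b).
  { intros f Hf. apply (ex_RInt_smooth_real U); [lra | exact HsU | exact Hf]. }
  (* [chi (g, h o k) = A + B], [chi (h, k) = C], [chi (g o h, k) = B + C], and
     [chi (g, h) = A] by the substitution [y = k x]. *)
  set (A := fun x => Lg (fn h (fn k x)) * Derive (fun x => Lh (fn k x)) x).
  set (B := fun x => Lg (fn h (fn k x)) * Derive Lk x).
  set (C := fun x => Lh (fn k x) * Derive Lk x).
  assert (HA : ex_RInt A a b) by (apply Hex, smooth_mult; assumption).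
  assert (HB : ex_RInt B a b) by (apply Hex, smooth_mult; assumption).
  assert (HC : ex_RInt C a b) by (apply Hex, smooth_mult; assumption).
  assert (EC : chi h k = RInt C a b) by reflexivity.
  assert (EAB : chi g (comp h k) = RInt A a b + RInt B a b).
  { rewrite <- (RInt_plus (V := R_CompleteNormedModule) A B) by assumption.
    apply RInt_ext. rewrite Rmin_left, Rmax_right by (cbn; fold a b; lra).
    intros x Hx. assert (HUx : U x) by (apply HsU; cbn in Hx; fold a b in Hx; lra).
    transitivity (Lg (fn h (fn k x)) * (Derive (fun x => Lh (fn k x)) x + Derive Lk x));
      [| apply Rmult_plus_distr_l].
    apply (f_equal (Rmult _)). cbn [comp fn].
    rewrite <- (Derive_plus (fun x => Lh (fn k x)) Lk) by
      (eexists; apply (smooth_is_derive U); assumption).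
    apply (Derive_ext_open U); [exact HU | | exact HUx].
    intros y (Hy & Hky & _). apply (logd_comp Uh Uk); auto. }
  assert (EBC : chi (comp g h) k = RInt B a b + RInt C a b).
  { rewrite <- (RInt_plus (V := R_CompleteNormedModule) B C) by assumption.
    apply RInt_ext. fold a b. rewrite Rmin_left, Rmax_right by lra.
    intros x Hx. destruct (HsU x) as (Hx' & Hkx & Hhkx); [lra |].
    transitivity ((Lg (fn h (fn k x)) + Lh (fn k x)) * Derive Lk x);
      [| apply Rmult_plus_distr_r].
    apply (f_equal2 Rmult); [| reflexivity].
    apply (logd_comp Ug Uh (fn g) (fn h)); auto. }
  assert (EA : chi g h = RInt A a b).
  { rewrite chi_logd, Chk. symmetry.
    etransitivity; [| apply (RInt_comp (V := R_CompleteNormedModule)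
      (fun y => Lg (fn h y) * Derive Lh y) (fn k) (Derive (fn k)) a b)].
    - apply RInt_ext. rewrite Rmin_left, Rmax_right by lra.
      intros x Hx. destruct (HsU x) as (Hx' & Hkx & _); [lra |].
      unfold A. rewrite (Derive_comp Lh (fn k)) by
        (eexists; first [apply (smooth_is_derive Uh); assumption
                        | apply (smooth_is_derive Uk); assumption]).
      unfold scal; cbn; unfold mult; cbn. ring.
    - rewrite Rmin_left, Rmax_right by lra. intros x Hx. destruct (HsU x Hx) as (Hx' & Hkx).
      apply (smooth_continuous Ugh (fun y => Lg (fn h y) * Derive Lh y)); [| exact Hkx].
      apply smooth_mult; [exact HUgh | exact HLgh | apply smooth_Derive; assumption].
    - rewrite Rmin_left, Rmax_right by lra. intros x Hx. destruct (HsU x Hx) as (Hx' & _).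
      split; [apply (smooth_is_derive Uk); assumption |].
      apply (smooth_continuous Uk (Derive (fn k))); [apply smooth_Derive |]; assumption. }
  rewrite EAB, EC, EBC, EA. ring.
Qed.

Lemma chi_groupoid_cocycle : groupoid_cocycle chi.
Proof.
  split.
  - intros g g' h h' _ _ Hh _. apply chi_arrow_eq, Hh.
  - exact chi_cocycle_identity.
Qed.

(** ** The central extension *)

Lemma chi_id_l (q : R * R) (h : arrow) : chi (id_arrow q) h = 0.
Proof.
  unfold chi. rewrite (RInt_ext _ (fun _ => 0)).
  - rewrite (RInt_const (V := R_CompleteNormedModule)). apply Rmult_0_r.
  - intros x _. cbn. rewrite Derive_id, ln_1. apply Rmult_0_l.
Qed.

Lemma chi_id_r (q : R * R) (g : arrow) : chi g (id_arrow q) = 0.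
Proof.
  unfold chi. rewrite (RInt_ext _ (fun _ => 0)).
  - rewrite (RInt_const (V := R_CompleteNormedModule)). apply Rmult_0_r.
  - intros x _. cbn. rewrite (Derive_ext (fun y => ln (Derive (fun x => x) y)) (fun _ => 0)).
    + rewrite Derive_const. apply Rmult_0_r.
    + intros y. rewrite Derive_id. apply ln_1.
Qed.

Lemma bdiff_id (q : R * R) : P q -> is_bdiff (id_arrow q).
Proof.
  intros Hq.
  assert (Hid : smooth_on (seg q) (fun x : R => x)).
  { apply (smooth_smooth_on (seg q) (fun _ : R_NormedModule => True));
      [apply open_true | auto | apply smooth_linear; [apply open_true | apply is_linear_id]]. }
  split; [exact Hq | split; [exact Hid | split; [auto |]]].
  assert (Ht : trg (id_arrow q) = q) by (symmetry; apply surjective_pairing).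
  exists (fun x => x). rewrite Ht. auto.
Qed.

Lemma bdiff_comp (g h : arrow) :
  is_bdiff g -> is_bdiff h -> composable g h -> is_bdiff (comp g h).
Proof.
  intros Hg Hh Hc. unfold composable in Hc.
  pose proof (fun x => bdiff_maps h x Hh) as Mh. rewrite <- Hc in Mh.
  pose proof Hg as (_ & (Ug & HUg & Sg & SUg) & mg & kg & (Wg & HWg & Tg & SWg) & Kg1 & Kg2).
  pose proof Hh as (HP & (Uh & HUh & Sh & SUh) & mh & kh & (Wh & HWh & Th & SWh) & Kh1 & Kh2).
  assert (Ht : trg (comp g h) = trg g).
  { unfold trg. cbn. rewrite Hc. reflexivity. }
  split; [exact HP | split; [| split]].
  - apply (smooth_smooth_on _ (fun x => Uh x /\ Ug (fn h x)));
      [apply open_preimage_real; assumption |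
       | apply (smooth_comp_real Uh Ug (fn g) (fn h)); assumption].
    intros x Hx. split; [exact (Sh x Hx) | exact (Sg _ (Mh x Hx))].
  - intros x y Hx Hy Hxy. apply mg; auto.
  - exists (fun y => kh (kg y)). rewrite Ht. rewrite <- Hc in Kh2, Th. split; [| split].
    + apply (smooth_smooth_on _ (fun x => Wg x /\ Wh (kg x)));
        [apply open_preimage_real; assumption |
         | apply (smooth_comp_real Wg Wh kh kg); assumption].
      intros y Hy. split; [exact (Tg y Hy) | exact (Th _ (proj1 (Kg2 y Hy)))].
    + intros x Hx. cbn in *. rewrite Kg1, Kh1 by auto. reflexivity.
    + intros y Hy. destruct (Kg2 y Hy) as [Hy1 Hy2]. destruct (Kh2 _ Hy1) as [Hy3 Hy4].
      cbn. rewrite Hy4. auto.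
Qed.

Lemma bdiff_inverse (g : arrow) :
  is_bdiff g ->
  exists h, is_bdiff h /\ src h = trg g /\ trg h = src g /\
    arrow_eq (comp g h) (id_arrow (trg g)) /\ arrow_eq (comp h g) (id_arrow (src g)).
Proof.
  intros Hg. pose proof (P_trg g Hg) as Ht.
  pose proof Hg as (HP & Sg & mg & k & Sk & K1 & K2). unfold P in HP.
  exists (Arrow (trg g) k).
  assert (Hk : trg (Arrow (trg g) k) = src g).
  { unfold trg at 1; cbn. rewrite !K1 by (unfold seg; lra). symmetry; apply surjective_pairing. }
  split; [| split; [reflexivity | split; [exact Hk | split; split]]].
  - split; [exact Ht | split; [exact Sk | split]].
    + intros x y Hx Hy Hxy. cbn in *. destruct (K2 x Hx) as [Hx1 Hx2].
      destruct (K2 y Hy) as [Hy1 Hy2]. apply Rnot_le_lt. intros [Hlt | Heq].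
      * pose proof (mg _ _ Hy1 Hx1 Hlt). lra.
      * rewrite Heq in Hy2. lra.
    + exists (fn g). rewrite Hk. split; [exact Sg | split].
      * intros y Hy. apply K2, Hy.
      * intros x Hx. split; [apply bdiff_maps; assumption | apply K1, Hx].
  - reflexivity.
  - intros y Hy. apply K2, Hy.
  - reflexivity.
  - intros x Hx. apply K1, Hx.
Qed.

#[local] Instance arrow_eq_equiv : Equivalence arrow_eq.
Proof.
  split.
  - intros g. split; reflexivity.
  - intros g h [Hs Hf]. split; [auto |]. rewrite <- Hs. intros x Hx. symmetry. auto.
  - intros g h k [Hs Hf] [Hs' Hf']. split; [congruence |].
    intros x Hx. rewrite Hf by exact Hx. apply Hf'. rewrite <- Hs. exact Hx.
Qed.

(** Since [chi] vanishes on units, [ext_line chi q r] is [(id_arrow q, r)]. *)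
Lemma chi_central_extension : central_extension chi.
Proof.
  assert (Hone : forall q r, ext_line chi q r = (id_arrow q, r)).
  { intros q r. unfold ext_line. rewrite chi_id_l. f_equal. ring. }
  split; [split | split].
  - split.
    + intros e. split; reflexivity.
    + intros e f [H1 H2]. split; [symmetry; exact H1 | auto].
    + intros e f k [H1 H2] [H3 H4]. split; [transitivity (fst f); assumption | congruence].
  - intros e He. split; [exact (proj1 He) | exact (P_trg _ He)].
  - intros e f [[Hs _] _]. exact Hs.
  - intros e f [HP _] _ [[Hs Hf] _]. unfold P in HP. unfold trg. rewrite <- Hs.
    rewrite !Hf by (unfold seg; lra). reflexivity.
  - intros q Hq. rewrite Hone. split; [exact (bdiff_id q Hq) |].
    split; [reflexivity | symmetry; apply surjective_pairing].
  - intros e f He Hf Hc. split; [apply bdiff_comp; assumption |]. split; [reflexivity |].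
    unfold trg; cbn. rewrite Hc. reflexivity.
  - intros e e' f f' He He' Hf Hf' [H1 H2] [H3 H4] Hc.
    assert (Hchi : chi (fst e) (fst f) = chi (fst e') (fst f')) by (apply chi_arrow_eq; assumption).
    split; [| exact (f_equal2 Rplus (f_equal2 Rplus H2 H4) Hchi)].
    destruct H1 as [_ H1], H3 as [Hs H3]. split; [exact Hs |].
    intros x Hx. cbn in *. rewrite <- H3 by exact Hx. apply H1. rewrite Hc.
    apply bdiff_maps; assumption.
  - intros e f k He Hf Hk H1 H2. split; [split; reflexivity |]. cbn [ext_mul fst snd].
    pose proof (chi_cocycle_identity (fst e) (fst f) (fst k) He Hf Hk H1 H2). lra.
  - intros e He. rewrite Hone. split; [split; reflexivity |].
    cbn [ext_mul fst snd]. rewrite chi_id_l. ring.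
  - intros e He. rewrite Hone. split; [split; reflexivity |].
    cbn [ext_mul fst snd]. rewrite chi_id_r. ring.
  - intros e He. destruct (bdiff_inverse (fst e) He) as (h & Hh & Hs & Ht & H1 & H2).
    (* The cocycle identity for [(e, h, e)] makes the right inverse a left inverse. *)
    assert (Hchi : chi (fst e) h = chi h (fst e)).
    { pose proof (chi_cocycle_identity (fst e) h (fst e) He Hh He (eq_sym Ht) Hs) as H.
      assert (E1 : chi (fst e) (comp h (fst e)) = 0).
      { rewrite <- (chi_id_r (src (fst e)) (fst e)).
        apply chi_arrow_eq; [apply bdiff_comp | reflexivity | exact H2 |]; try assumption.
        unfold composable, trg; cbn. rewrite <- Ht at 1. unfold trg. rewrite Hs. reflexivity. }
      assert (E2 : chi (comp (fst e) h) (fst e) = 0).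
      { rewrite <- (chi_id_l (trg (fst e)) (fst e)).
        apply chi_arrow_eq; [exact He | exact H1 | reflexivity | exact Hs]. }
      lra. }
    exists (h, - snd e - chi (fst e) h).
    split; [exact Hh | split; [exact Hs | split; [exact Ht |]]].
    rewrite !Hone. split; split; cbn [ext_mul fst snd];
      [exact H1 | ring | exact H2 | rewrite Hchi; ring].
  - intros q r s Hq. rewrite !Hone. split; [split; reflexivity |]. cbn [ext_mul fst snd].
    rewrite chi_id_l. ring.
  - intros e r He. rewrite !Hone. split; [split; reflexivity |]. cbn [ext_mul fst snd].
    rewrite chi_id_l, chi_id_r. ring.
Qed.

(** * The algebroid cocycle *)

(** Derivative in [x], and derivative along [w] in the endpoints [q = (a, b)],
    of a function of [(x, q)]. *)
Definition dx (f : R * (R * R) -> R) : R * (R * R) -> R := dirderiv f (1, (0, 0)).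
Definition dq (w : R * R) (f : R * (R * R) -> R) : R * (R * R) -> R := dirderiv f (0, w).

Lemma dx_Derive (f : R * (R * R) -> R) (x : R) (q : R * R) :
  dx f (x, q) = Derive (fun y => f (y, q)) x.
Proof. apply (dirderiv_line f _ _ (fun y => (y, q) : R * (R * R))). solve_line. Qed.

Lemma dq_dirderiv (f : R * (R * R) -> R) (w : R * R) (x : R) (q : R * R) :
  dq w f (x, q) = dirderiv (fun q => f (x, q)) w q.
Proof. unfold dq, dirderiv. apply Derive_ext. intros h. f_equal. solve_line. Qed.

(** Differentiability makes the partial derivatives in [a] and [b] assemble into a
    derivative along the anchor. *)
Lemma lie_anchor_dirderiv (u : R * R -> R -> R) (F : R * R -> R) (q : R * R) :
  ex_filterdiff F (locally q) ->
  lie_anchor u F q = dirderiv F (u q (fst q), u q (snd q)) q.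
Proof.
  intros HF. destruct q as [a b]. unfold lie_anchor; cbn.
  pose proof (ex_filterdiff_dirderiv F _ HF) as [Hl _].
  set (s := u (a, b) a). set (t := u (a, b) b).
  rewrite <- (dirderiv_line F (1, 0) (a, b) (fun a => (a, b) : R * R)) by solve_line.
  rewrite <- (dirderiv_line F (0, 1) (a, b) (fun b => (a, b) : R * R)) by solve_line.
  replace ((s, t) : R * R) with (plus (scal s (1, 0)) (scal t (0, 1)) : R * R) by solve_line.
  rewrite (linear_plus _ Hl), !(linear_scal _ Hl). reflexivity.
Qed.

Lemma Omega_ext (q : R * R) (u u' v : R -> R) :
  P q -> (forall x, seg q x -> u x = u' x) -> Omega q u v = Omega q u' v.
Proof.
  intros Hq Hu. apply RInt_ext. unfold P in Hq.
  rewrite Rmin_left, Rmax_right by lra. intros x Hx.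
  assert (HD : forall y, fst q < y < snd q -> Derive u y = Derive u' y).
  { intros y Hy. apply (Derive_ext_open (fun x => fst q < x < snd q));
      [apply open_seg_interior | | exact Hy].
    intros z Hz. apply Hu. unfold seg. lra. }
  rewrite !Derive_n_2, HD by exact Hx. f_equal. f_equal.
  apply (Derive_ext_open (fun x => fst q < x < snd q));
    [apply open_seg_interior | exact HD | exact Hx].
Qed.

Lemma smooth_density_real (U : R -> Prop) (u v : R -> R) :
  open U -> smooth U u -> smooth U v ->
  smooth U (fun x => Derive u x * Derive_n v 2 x - Derive_n u 2 x * Derive v x).
Proof.
  intros HU Hu Hv. apply smooth_minus; [exact HU | |];
    (apply smooth_mult; [exact HU | |]); repeat apply (smooth_Derive U); assumption.
Qed.

Lemma Derive_smooth_combination (U : R -> Prop) (u v : R -> R) (c x : R) :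
  smooth U u -> smooth U v -> U x ->
  Derive (fun x => c * u x + v x) x = c * Derive u x + Derive v x.
Proof.
  intros Hu Hv Hx.
  apply is_derive_unique, (is_derive_plus (fun x => c * u x) v).
  - apply is_derive_scal. apply (smooth_is_derive U); assumption.
  - apply (smooth_is_derive U); assumption.
Qed.

Lemma Omega_fiberwise : fiberwise_skew_form Omega.
Proof.
  intros q Hq u v w (Uu & HUu & HuU & Hu) (Uv & HUv & HvU & Hv) (Uw & HUw & HwU & Hw).
  split; [| split].
  - intros Huv. apply Omega_ext; assumption.
  - unfold P in Hq. unfold Omega.
    rewrite <- (RInt_opp (V := R_CompleteNormedModule)).
    + apply RInt_ext. intros x _.
      set (c := Derive_n u 2 x). set (d := Derive_n v 2 x).
      change (Derive u x * d - c * Derive v x = - (Derive v x * c - d * Derive u x)). ring.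
    + apply (ex_RInt_smooth_real (fun x => Uv x /\ Uu x)); [lra | split; auto |].
      apply smooth_density_real; [apply open_and; assumption | |].
      * apply smooth_subset with (2 := Hv). tauto.
      * apply smooth_subset with (2 := Hu). tauto.
  - intros c. unfold P in Hq. unfold Omega.
    set (U := fun x => Uu x /\ Uv x /\ Uw x).
    assert (HU : open U) by (repeat apply open_and; assumption).
    assert (HqU : forall x, fst q <= x <= snd q -> U x) by (repeat split; auto).
    assert (Hu' : smooth U u) by (apply smooth_subset with (2 := Hu); unfold U; tauto).
    assert (Hv' : smooth U v) by (apply smooth_subset with (2 := Hv); unfold U; tauto).
    assert (Hw' : smooth U w) by (apply smooth_subset with (2 := Hw); unfold U; tauto).
    assert (Hle : fst q <= snd q) by lra.
    assert (Hex : forall f, smooth U f ->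
      ex_RInt (fun x => Derive f x * Derive_n w 2 x - Derive_n f 2 x * Derive w x)
        (fst q) (snd q)).
    { intros f Hf. apply (ex_RInt_smooth_real U); auto using smooth_density_real. }
    transitivity (RInt (fun x =>
      plus (scal c (Derive u x * Derive_n w 2 x - Derive_n u 2 x * Derive w x))
           (Derive v x * Derive_n w 2 x - Derive_n v 2 x * Derive w x)) (fst q) (snd q)).
    + apply RInt_ext. rewrite Rmin_left, Rmax_right by lra. intros x Hx.
      assert (HUx : U x) by (apply HqU; lra). rewrite !Derive_n_2.
      rewrite (Derive_ext_open U (Derive (fun x => c * u x + v x))
                 (fun x => c * Derive u x + Derive v x) x HU); [| | exact HUx].
      * rewrite !(Derive_smooth_combination U) by auto using smooth_Derive.
        unfold plus, scal; cbn; unfold mult; cbn. ring.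
      * intros y Hy. apply (Derive_smooth_combination U); assumption.
    + rewrite (RInt_plus (V := R_CompleteNormedModule)), (RInt_scal (V := R_CompleteNormedModule));
        [reflexivity | apply Hex, Hu' | apply (ex_RInt_scal (V := R_NormedModule)), Hex, Hu'
        | apply Hex, Hv'].
Qed.

(** The integrand of [Omega] on two sections, as a function of [(x, q)]. *)
Definition density (f g : R * (R * R) -> R) (p : R * (R * R)) : R :=
  dx f p * dx (dx g) p - dx (dx f) p * dx g p.

Lemma smooth_dx (U : R * (R * R) -> Prop) f : smooth U f -> smooth U (dx f).
Proof. apply smooth_dirderiv. Qed.

Lemma smooth_dq (U : R * (R * R) -> Prop) w f : smooth U f -> smooth U (dq w f).
Proof. apply smooth_dirderiv. Qed.

Lemma smooth_density (U : R * (R * R) -> Prop) f g :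
  open U -> smooth U f -> smooth U g -> smooth U (density f g).
Proof.
  intros HU Hf Hg. apply smooth_minus; [exact HU | |];
    (apply smooth_mult; [exact HU | |]); repeat apply smooth_dx; assumption.
Qed.

Lemma Omega_density (f g : R * (R * R) -> R) (q : R * R) :
  Omega q (fun x => f (x, q)) (fun x => g (x, q)) =
  RInt (fun x => density f g (x, q)) (fst q) (snd q).
Proof.
  apply RInt_ext. intros x _. unfold density. rewrite !dx_Derive, !Derive_n_2.
  rewrite <- (Derive_ext (fun y => dx f (y, q)) _ x (fun y => dx_Derive f y q)).
  rewrite <- (Derive_ext (fun y => dx g (y, q)) _ x (fun y => dx_Derive g y q)).
  reflexivity.
Qed.

Section Bracket.
Variables (U : R * (R * R) -> Prop) (HU : open U) (HfU : forall p, fibers p -> U p).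
Variables (q : R * R) (Hq : P q).

Lemma fiber_in x : seg q x -> U (x, q).
Proof using HfU Hq. intros Hx. apply HfU. split; assumption. Qed.

Lemma smooth_ex_filterdiff_fiber f x :
  smooth U f -> seg q x -> ex_filterdiff (fun q' => f (x, q')) (locally q).
Proof using HU HfU Hq.
  intros Hf Hx.
  set (T := fun _ : R * R => True).
  assert (HT : open T) by apply open_true.
  set (m := fun q' : R * R => (x, (fst q', snd q'))).
  assert (Hm : smooth_map (V := prod_NormedModule R_AbsRing R_NormedModule R_NormedModule)
                 (W := prod_NormedModule R_AbsRing R_NormedModule
                         (prod_NormedModule R_AbsRing R_NormedModule R_NormedModule)) T m).
  { apply smooth_map_pair; [| apply smooth_map_pair]; apply smooth_map_real.
    - apply smooth_const, HT.
    - apply smooth_linear; [exact HT | exact is_linear_fst].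
    - apply smooth_linear; [exact HT | exact is_linear_snd]. }
  pose proof (smooth_comp T U m f HT HU Hm Hf) as Hfm.
  assert (HTU : T q /\ U (m q)).
  { split; [exact I |]. unfold m. rewrite <- surjective_pairing. apply fiber_in, Hx. }
  destruct (smooth_ex_filterdiff _ _ q Hfm HTU) as [l Hl].
  exists l. apply filterdiff_ext with (2 := Hl). intros []; reflexivity.
Qed.

(** The bracket of the sections [f] and [g] near the segment [q], as a smooth
    function of [(x, q')]; [wf] and [wg] stand for the values at [q] of their
    anchors, kept fixed when [q'] varies. *)
Definition bracket_fun (wf wg : R * R) (f g : R * (R * R) -> R) (p : R * (R * R)) : R :=
  f p * dx g p - g p * dx f p + (dq wf g p - dq wg f p).

(** The anchor of [f] at [q]. *)
Definition anchor_at (f : R * (R * R) -> R) : R * R := (f (fst q, q), f (snd q, q)).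

Lemma smooth_bracket_fun wf wg f g :
  smooth U f -> smooth U g -> smooth U (bracket_fun wf wg f g).
Proof using HU.
  intros Hf Hg. apply smooth_plus; [exact HU | |]; (apply smooth_minus; [exact HU | |]);
    auto using smooth_mult, smooth_dx, smooth_dq.
Qed.

Lemma bracket_eq f g x :
  smooth U f -> smooth U g -> seg q x ->
  bracket (fun q x => f (x, q)) (fun q x => g (x, q)) q x =
  bracket_fun (anchor_at f) (anchor_at g) f g (x, q).
Proof using HU HfU Hq.
  intros Hf Hg Hx. unfold bracket, bracket_fun.
  rewrite !lie_anchor_dirderiv, !dx_Derive, !dq_dirderiv
    by (apply smooth_ex_filterdiff_fiber; assumption).
  apply Rplus_assoc.
Qed.

Lemma Omega_bracket f g h :
  smooth U f -> smooth U g ->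
  Omega q (bracket (fun q x => f (x, q)) (fun q x => g (x, q)) q) (fun x => h (x, q)) =
  RInt (fun x => density (bracket_fun (anchor_at f) (anchor_at g) f g) h (x, q))
    (fst q) (snd q).
Proof using HU HfU Hq.
  intros Hf Hg. rewrite <- Omega_density. apply Omega_ext; [exact Hq |].
  intros x. apply bracket_eq; assumption.
Qed.

Lemma ex_RInt_fiber f : smooth U f -> ex_RInt (fun x => f (x, q)) (fst q) (snd q).
Proof using HfU Hq.
  intros Hf. apply (smooth_ex_RInt U); [exact Hf |].
  unfold P in Hq. rewrite Rmin_left, Rmax_right by lra. exact fiber_in.
Qed.

(** The derivative of [Omega(g, h)] along the anchor of [f]; the contribution of
    the moving endpoints is written as an integral over the segment. *)
Lemma lie_anchor_Omega f g h :
  smooth U f -> smooth U g -> smooth U h ->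
  lie_anchor (fun q x => f (x, q))
    (fun q' => Omega q' (fun x => g (x, q')) (fun x => h (x, q'))) q =
  RInt (fun x => dq (anchor_at f) (density g h) (x, q)
                 + dx (fun p => f p * density g h p) (x, q)) (fst q) (snd q).
Proof using HU HfU Hq.
  intros Hf Hg Hh. pose proof (smooth_density U g h HU Hg Hh) as HD.
  set (D := density g h) in *.
  set (J := fun q => RInt (fun x => D (x, q)) (fst q) (snd q)).
  assert (HJ : forall q', J q' = Omega q' (fun x => g (x, q')) (fun x => h (x, q'))).
  { intros q'. symmetry. apply Omega_density. }
  assert (HJs : smooth P J) by (apply (smooth_RInt_fibers U); assumption).
  assert (HfD : smooth U (fun p => f p * D p)) by (apply smooth_mult; assumption).
  rewrite lie_anchor_dirderiv.
  2:{ destruct (smooth_ex_filterdiff P J q HJs Hq) as [l Hl]. exists l.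
      apply filterdiff_ext with (2 := Hl). exact HJ. }
  unfold P in Hq.
  transitivity (RInt (fun x => dq (anchor_at f) D (x, q)) (fst q) (snd q)
                + (f (snd q, q) * D (snd q, q) - f (fst q, q) * D (fst q, q))).
  - apply is_derive_unique.
    apply is_derive_ext with (f := fun k : R =>
      RInt (fun x : R => D (x, plus q (scal k (anchor_at f))))
        (fst q + k * f (fst q, q)) (snd q + k * f (snd q, q))).
    { intros k. apply (HJ (plus q (scal k (anchor_at f)))). }
    evar_last.
    + apply (is_derive_RInt_line U D (fun k => fst q + k * f (fst q, q))
               (fun k => snd q + k * f (snd q, q)) (f (fst q, q)) (f (snd q, q)) q
               (anchor_at f) HU HD).
      * lra.
      * intros x Hx. apply fiber_in. unfold seg. lra.
      * auto_derive; [trivial | ring].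
      * auto_derive; [trivial | ring].
    + cbn beta. rewrite !Rmult_0_l, !Rplus_0_r. unfold dq. cbn. ring.
  - rewrite (RInt_plus (V := R_CompleteNormedModule)); [| apply ex_RInt_fiber..].
    + apply (f_equal (Rplus _)).
      rewrite (RInt_ext _ (Derive (fun x => f (x, q) * D (x, q)))).
      * symmetry. rewrite RInt_Derive; [reflexivity | |];
          rewrite Rmin_left, Rmax_right by lra; intros x Hx.
        -- eexists. apply (is_derive_line U (fun p => f p * D p) (1, (0, 0)) (x, q)
             (fun y => (y, q) : R * (R * R)) x HfD); [apply fiber_in, Hx | solve_line].
        -- apply continuous_ext with (f := fun x => dx (fun p => f p * D p) (x, q)).
           { intros y. apply dx_Derive. }
           apply (smooth_slice_continuous U (dx (fun p => f p * D p)));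
             [apply smooth_dx, HfD | apply fiber_in, Hx].
      * intros x _. apply dx_Derive.
    + apply smooth_dq, HD.
    + apply smooth_dx, HfD.
Qed.

End Bracket.

(** ** The cyclic sum *)
Section Identity.
Variables (U : R * (R * R) -> Prop) (HU : open U).
Implicit Types (f g h : R * (R * R) -> R) (p v : R * (R * R)).

Lemma dirderiv_mult_on f g v p :
  smooth U f -> smooth U g -> U p ->
  dirderiv (fun p => f p * g p) v p = dirderiv f v p * g p + f p * dirderiv g v p.
Proof. intros. apply dirderiv_mult; eapply smooth_ex_filterdiff; eassumption. Qed.

Lemma dirderiv_minus_on f g v p :
  smooth U f -> smooth U g -> U p ->
  dirderiv (fun p => f p - g p) v p = dirderiv f v p - dirderiv g v p.
Proof. intros. apply dirderiv_minus; eapply smooth_ex_filterdiff; eassumption. Qed.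

Lemma dirderiv_plus_on f g v p :
  smooth U f -> smooth U g -> U p ->
  dirderiv (fun p => f p + g p) v p = dirderiv f v p + dirderiv g v p.
Proof. intros. apply dirderiv_plus; eapply smooth_ex_filterdiff; eassumption. Qed.

Lemma dx_dq w f p : smooth U f -> U p -> dx (dq w f) p = dq w (dx f) p.
Proof using HU. intros Hf Hp. apply (dirderiv_comm U); assumption. Qed.

Lemma dirderiv_density f g v p :
  smooth U f -> smooth U g -> U p ->
  dirderiv (density f g) v p =
  dirderiv (dx f) v p * dx (dx g) p + dx f p * dirderiv (dx (dx g)) v p
  - (dirderiv (dx (dx f)) v p * dx g p + dx (dx f) p * dirderiv (dx g) v p).
Proof using HU.
  intros Hf Hg Hp. unfold density.
  rewrite dirderiv_minus_on, !dirderiv_mult_on; auto 6 using smooth_mult, smooth_dx.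
Qed.

Lemma dx_bracket_fun wf wg f g p :
  smooth U f -> smooth U g -> U p ->
  dx (bracket_fun wf wg f g) p =
  f p * dx (dx g) p - g p * dx (dx f) p + (dq wf (dx g) p - dq wg (dx f) p).
Proof using HU.
  intros Hf Hg Hp. unfold bracket_fun.
  rewrite <- !dx_dq by assumption. unfold dx at 1.
  rewrite dirderiv_plus_on, !dirderiv_minus_on, !dirderiv_mult_on;
    auto 6 using smooth_mult, smooth_minus, smooth_dx, smooth_dq.
  unfold dx. ring.
Qed.

Lemma dx_dx_bracket_fun wf wg f g p :
  smooth U f -> smooth U g -> U p ->
  dx (dx (bracket_fun wf wg f g)) p =
  dx f p * dx (dx g) p + f p * dx (dx (dx g)) p
  - (dx g p * dx (dx f) p + g p * dx (dx (dx f)) p)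
  + (dq wf (dx (dx g)) p - dq wg (dx (dx f)) p).
Proof using HU.
  intros Hf Hg Hp. unfold dx at 1.
  rewrite (dirderiv_ext U _ _ _ p HU (fun p Hp => dx_bracket_fun wf wg f g p Hf Hg Hp) Hp).
  rewrite <- !(dx_dq _ (dx _)) by auto using smooth_dx.
  rewrite dirderiv_plus_on, !dirderiv_minus_on, !dirderiv_mult_on;
    auto 6 using smooth_mult, smooth_minus, smooth_dx, smooth_dq.
Qed.

(** The integrand of one of the three terms of the cyclic sum. *)
Definition cyclic_term (wf wg : R * R) f g h p : R :=
  dq wf (density g h) p + dx (fun p => f p * density g h p) p
  - density (bracket_fun wf wg f g) h p.

Lemma smooth_cyclic_term wf wg f g h :
  smooth U f -> smooth U g -> smooth U h -> smooth U (cyclic_term wf wg f g h).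
Proof using HU.
  intros Hf Hg Hh.
  apply smooth_minus; [exact HU | apply smooth_plus; [exact HU | |] |].
  - apply smooth_dq, smooth_density; assumption.
  - apply smooth_dx, smooth_mult, smooth_density; assumption.
  - apply smooth_density; [exact HU | apply (smooth_bracket_fun U) | ]; assumption.
Qed.

(** Terms with derivatives in the endpoints cancel by skew-symmetry, the others as
    in the cocycle identity for vector fields on the line. *)
Lemma cyclic_sum_zero wf wg wh f g h p :
  smooth U f -> smooth U g -> smooth U h -> U p ->
  cyclic_term wf wg f g h p + cyclic_term wg wh g h f p + cyclic_term wh wf h f g p = 0.
Proof using HU.
  assert (E : forall wf wg f g h, smooth U f -> smooth U g -> smooth U h -> U p ->
    cyclic_term wf wg f g h p =
    dq wf (density g h) p + (dx f p * density g h p + f p * dx (density g h) p)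
    - density (bracket_fun wf wg f g) h p).
  { intros. unfold cyclic_term. do 2 f_equal.
    apply dirderiv_mult_on; auto using smooth_density. }
  intros Hf Hg Hh Hp. rewrite !E by assumption.
  assert (Eq : forall w f g, smooth U f -> smooth U g ->
    dq w (density f g) p = dq w (dx f) p * dx (dx g) p + dx f p * dq w (dx (dx g)) p
    - (dq w (dx (dx f)) p * dx g p + dx (dx f) p * dq w (dx g) p)).
  { intros. apply dirderiv_density; assumption. }
  assert (Ex : forall f g, smooth U f -> smooth U g ->
    dx (density f g) p = dx (dx f) p * dx (dx g) p + dx f p * dx (dx (dx g)) p
    - (dx (dx (dx f)) p * dx g p + dx (dx f) p * dx (dx g) p)).
  { intros. apply dirderiv_density; assumption. }
  rewrite !Eq, !Ex by assumption.
  unfold density. rewrite !dx_dx_bracket_fun, !dx_bracket_fun by assumption.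
  ring.
Qed.

End Identity.

Lemma Omega_algebroid_cocycle : algebroid_cocycle Omega.
Proof.
  split; [exact Omega_fiberwise | split].
  - intros u v (Uu & HUu & HuU & Hu) (Uv & HUv & HvU & Hv).
    set (f := fun p : R * (R * R) => u (snd p) (fst p)) in Hu.
    set (g := fun p : R * (R * R) => v (snd p) (fst p)) in Hv.
    apply (smooth_smooth_on P P); [exact open_P | auto |].
    apply smooth_ext with (f := fun q => RInt (fun x => density f g (x, q)) (fst q) (snd q)).
    + exact open_P.
    + intros q _. symmetry. apply (Omega_density f g q).
    + apply (smooth_RInt_fibers (fun p => Uu p /\ Uv p)); [apply open_and; assumption | auto |].
      apply smooth_density; [apply open_and; assumption | |].
      * apply smooth_subset with (2 := Hu). tauto.
      * apply smooth_subset with (2 := Hv). tauto.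
  - intros u v w (Uu & HUu & HuU & Hu) (Uv & HUv & HvU & Hv) (Uw & HUw & HwU & Hw) q Hq.
    set (f := fun p : R * (R * R) => u (snd p) (fst p)) in Hu.
    set (g := fun p : R * (R * R) => v (snd p) (fst p)) in Hv.
    set (h := fun p : R * (R * R) => w (snd p) (fst p)) in Hw.
    set (U := fun p => Uu p /\ Uv p /\ Uw p).
    assert (HU : open U) by (repeat apply open_and; assumption).
    assert (HfU : forall p, fibers p -> U p) by (repeat split; auto).
    assert (Hf : smooth U f) by (apply smooth_subset with (2 := Hu); unfold U; tauto).
    assert (Hg : smooth U g) by (apply smooth_subset with (2 := Hv); unfold U; tauto).
    assert (Hh : smooth U h) by (apply smooth_subset with (2 := Hw); unfold U; tauto).
    assert (Hterm : forall f g h, smooth U f -> smooth U g -> smooth U h ->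
      lie_anchor (fun q x => f (x, q))
        (fun q' => Omega q' (fun x => g (x, q')) (fun x => h (x, q'))) q
      - Omega q (bracket (fun q x => f (x, q)) (fun q x => g (x, q)) q) (fun x => h (x, q))
      = RInt (fun x => cyclic_term (anchor_at q f) (anchor_at q g) f g h (x, q))
          (fst q) (snd q)).
    { clear - HU HfU Hq. intros f g h Hf Hg Hh.
      rewrite (lie_anchor_Omega U), (Omega_bracket U) by assumption.
      symmetry. apply (RInt_minus (V := R_CompleteNormedModule)).
      - apply (ex_RInt_fiber U HfU q Hq (fun p => dq (anchor_at q f) (density g h) p
                 + dx (fun p => f p * density g h p) p)).
        apply smooth_plus; [exact HU | |].
        + apply smooth_dq, smooth_density; assumption.
        + apply smooth_dx, smooth_mult, smooth_density; assumption.
      - apply (ex_RInt_fiber U HfU q Hq), smooth_density; [exact HU | | exact Hh].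
        apply (smooth_bracket_fun U); assumption. }
    pose proof (Hterm f g h Hf Hg Hh) as E1. pose proof (Hterm g h f Hg Hh Hf) as E2.
    pose proof (Hterm h f g Hh Hf Hg) as E3.
    assert (Hex : forall wf wg f g h, smooth U f -> smooth U g -> smooth U h ->
      ex_RInt (fun x => cyclic_term wf wg f g h (x, q)) (fst q) (snd q)).
    { intros. apply (ex_RInt_fiber U HfU q Hq), smooth_cyclic_term; assumption. }
    etransitivity; [exact (f_equal2 Rplus (f_equal2 Rplus E1 E2) E3) |].
    rewrite <- (RInt_plus (V := R_CompleteNormedModule)) by auto.
    rewrite <- (RInt_plus (V := R_CompleteNormedModule));
      [| apply (ex_RInt_plus (V := R_NormedModule)); auto | auto].
    rewrite (RInt_ext _ (fun _ => 0)).
    + rewrite (RInt_const (V := R_CompleteNormedModule)). apply Rmult_0_r.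
    + unfold P in Hq. rewrite Rmin_left, Rmax_right by lra. intros x Hx.
      apply (cyclic_sum_zero U); try assumption. apply HfU.
      split; [exact Hq |]. unfold seg; cbn; lra.
Qed.

(** * The algebroid cocycle corresponding to [chi] *)

(** A family of bisections and the logarithm of its derivative in [x], as
    functions of [(t, (x, q))]. *)
Definition family_fun (phi : R -> R * R -> R -> R) (p : R * (R * (R * R))) : R :=
  phi (fst p) (snd (snd p)) (fst (snd p)).

Definition family_log (phi : R -> R * R -> R -> R) (p : R * (R * (R * R))) : R :=
  logd (phi (fst p) (snd (snd p))) (fst (snd p)).

(** Derivatives in [t] and in [x] of a function of [(t, (x, q))]. *)
Definition Dt (f : R * (R * (R * R)) -> R) : R * (R * (R * R)) -> R :=
  dirderiv f (1, (0, (0, 0))).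
Definition Dx (f : R * (R * (R * R)) -> R) : R * (R * (R * R)) -> R :=
  dirderiv f (0, (1, (0, 0))).

Lemma Dt_Derive f (t x : R) (q : R * R) : Dt f (t, (x, q)) = Derive (fun t => f (t, (x, q))) t.
Proof. apply (dirderiv_line f _ _ (fun t => (t, (x, q)) : R * (R * (R * R)))). solve_line. Qed.

Lemma Dx_Derive f (t x : R) (q : R * R) : Dx f (t, (x, q)) = Derive (fun x => f (t, (x, q))) x.
Proof. apply (dirderiv_line f _ _ (fun x => (t, (x, q)) : R * (R * (R * R)))). solve_line. Qed.

(** An open set on which the family and the logarithm of its derivative are
    smooth, and which contains all the fibers over times [t] with [|t| < eps]. *)
Definition family_nbhd (phi : R -> R * R -> R -> R) (eps : R)
    (U : R * (R * (R * R)) -> Prop) : Prop :=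
  open U /\ (forall t x q, Rabs t < eps -> P q -> seg q x -> U (t, (x, q))) /\
  smooth U (family_fun phi) /\ smooth U (family_log phi).

Lemma bisection_family_nbhd (phi : R -> R * R -> R -> R) (u : R * R -> R -> R) :
  bisection_family phi u -> exists (eps : posreal) U, family_nbhd phi eps U.
Proof.
  intros (eps & (U & HU & HsU & Hphi) & Hbis & _).
  change (smooth U (family_fun phi)) in Hphi.
  assert (HDx : forall t x q, Dx (family_fun phi) (t, (x, q)) = Derive (phi t q) x).
  { intros. apply Dx_Derive. }
  exists eps, (fun p => U p /\ 0 < Dx (family_fun phi) p).
  assert (HDs : smooth U (Dx (family_fun phi))) by apply smooth_dirderiv, Hphi.
  assert (HO : open (fun p => U p /\ 0 < Dx (family_fun phi) p)).
  { apply (open_preimage (W := R_NormedModule) U (fun y => 0 < y) (Dx (family_fun phi)));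
      [exact HU | exact open_positive | apply smooth_map_real, HDs]. }
  split; [exact HO | split; [| split]].
  - intros t x q Ht Hq Hx. split.
    + apply HsU. cbn. split; [exact Ht | split; assumption].
    + rewrite HDx. apply (bdiff_Derive_pos (at_source (phi t) q)); [| exact Hx].
      apply (Hbis t Ht), Hq.
  - apply smooth_subset with (2 := Hphi). tauto.
  - apply smooth_ext with (f := fun p => ln (Dx (family_fun phi) p)).
    + exact HO.
    + intros [t [x q]] _. unfold family_log, logd. cbn [fst snd]. f_equal. apply HDx.
    + apply smooth_comp_ln; [exact HO | apply smooth_subset with (2 := HDs); tauto | tauto].
Qed.

(** ** First-order expansion of a family at the identity *)
Section Expansion.
Variables (phi : R -> R * R -> R -> R) (u : R * R -> R -> R) (eps : posreal)
  (U : R * (R * (R * R)) -> Prop) (HU : family_nbhd phi eps U) (q : R * R) (Hq : P q).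
Hypothesis phi_0 : forall x, seg q x -> phi 0 q x = x.
Hypothesis phi_u : forall x, seg q x -> is_derive (fun t => phi t q x) 0 (u q x).

Let I (x : R) : Prop := fst q < x < snd q.

Let HI : open I.
Proof. apply open_seg_interior. Qed.

Let I_seg x : I x -> seg q x.
Proof. unfold I, seg. lra. Qed.

Let I_U x : I x -> U (0, (x, q)).
Proof.
  intros Hx. apply HU; [rewrite Rabs_R0; apply cond_pos | exact Hq | apply I_seg, Hx].
Qed.

Lemma Derive_family_0 x : I x -> Derive (phi 0 q) x = 1.
Proof using phi_0.
  intros Hx. rewrite (Derive_ext_open I _ (fun x => x) x HI); [apply Derive_id | | exact Hx].
  intros y Hy. apply phi_0, I_seg, Hy.
Qed.

Lemma family_log_0 x : I x -> family_log phi (0, (x, q)) = 0.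
Proof using phi_0.
  intros Hx. unfold family_log, logd. cbn [fst snd].
  rewrite Derive_family_0 by exact Hx. apply ln_1.
Qed.

Lemma Dx_family_log_0 x : I x -> Dx (family_log phi) (0, (x, q)) = 0.
Proof using phi_0.
  intros Hx. rewrite Dx_Derive, (Derive_ext_open I _ (fun _ => 0) x HI);
    [apply Derive_const | exact family_log_0 | exact Hx].
Qed.

Lemma Dt_family_log x : I x -> Dt (family_log phi) (0, (x, q)) = Derive (u q) x.
Proof using phi_0 phi_u HU Hq.
  intros Hx. destruct HU as (HO & _ & Hphi & _).
  rewrite Dt_Derive. unfold family_log, logd. cbn [fst snd].
  pose proof (smooth_dirderiv U _ (0, (1, (0, 0))) Hphi) as HDx. fold (Dx (family_fun phi)) in HDx.
  assert (HD : is_derive (fun t => Derive (phi t q) x) 0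
                 (Dt (Dx (family_fun phi)) (0, (x, q)))).
  { apply is_derive_ext with (f := fun t => Dx (family_fun phi) (t, (x, q))).
    { intros t. apply Dx_Derive. }
    apply (is_derive_line U (Dx (family_fun phi)) (1, (0, (0, 0))) (0, (x, q))
             (fun t => (t, (x, q)) : R * (R * (R * R))) 0 HDx);
      [apply I_U, Hx | solve_line]. }
  transitivity (Dt (Dx (family_fun phi)) (0, (x, q))).
  - apply is_derive_unique. evar_last.
    + apply (is_derive_comp ln (fun t => Derive (phi t q) x)); [| exact HD].
      apply is_derive_ln. rewrite Derive_family_0 by exact Hx. apply Rlt_0_1.
    + rewrite Derive_family_0, Rinv_1 by exact Hx. apply Rmult_1_r.
  - transitivity (Dx (Dt (family_fun phi)) (0, (x, q))).
    + apply (dirderiv_comm U); [exact HO | exact Hphi | apply I_U, Hx].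
    + rewrite Dx_Derive. apply (Derive_ext_open I); [exact HI | | exact Hx].
      intros y Hy. rewrite Dt_Derive. apply is_derive_unique, phi_u, I_seg, Hy.
Qed.

Lemma Dt_Dx_family_log x : I x -> Dt (Dx (family_log phi)) (0, (x, q)) = Derive_n (u q) 2 x.
Proof using phi_0 phi_u HU Hq.
  intros Hx. pose proof HU as (HO & _ & _ & Hlog).
  transitivity (Dx (Dt (family_log phi)) (0, (x, q))).
  - apply (dirderiv_comm U); [exact HO | exact Hlog | apply I_U, Hx].
  - rewrite Dx_Derive, Derive_n_2.
    apply (Derive_ext_open I); [exact HI | exact Dt_family_log | exact Hx].
Qed.

End Expansion.

(** ** The second-order expansion of [chi] *)
Section Mixed.
Variables (phi psi : R -> R * R -> R -> R) (q : R * R) (Hq : P q).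

(** The two factors of the integrand of [chi (phi^t, psi^s)] at the arrow of [psi^s]
    with source [q], as functions of [(x, (t, s))]; [chi_integrand] is their product. *)
Definition fst_factor (p : R * (R * R)) : R :=
  let s := snd (snd p) in
  family_log phi
    (fst (snd p), (psi s q (fst p), (psi s q (fst q), psi s q (snd q)))).

Definition snd_factor (p : R * (R * R)) : R := Dx (family_log psi) (snd (snd p), (fst p, q)).

Definition chi_integrand (p : R * (R * R)) : R := fst_factor p * snd_factor p.

Lemma chi_families (t s : R) :
  chi (at_source (phi t) (trg (at_source (psi s) q))) (at_source (psi s) q) =
  RInt (fun x => chi_integrand (x, (t, s))) (fst q) (snd q).
Proof.
  rewrite chi_logd. apply RInt_ext. intros x _. unfold chi_integrand, snd_factor.
  rewrite Dx_Derive. reflexivity.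
Qed.

Variables (eps eta : posreal) (U W : R * (R * (R * R)) -> Prop)
  (HU : family_nbhd phi eps U) (HW : family_nbhd psi eta W).
Hypothesis psi_0 : forall x, seg q x -> psi 0 q x = x.

Let HOU : open U := proj1 HU.
Let HOW : open W := proj1 HW.

Let place (c : R * (R * R) -> R) (p : R * (R * R)) : R * (R * (R * R)) :=
  (snd (snd p), (c p, (fst q, snd q))).
Let Dom0 (p : R * (R * R)) : Prop :=
  (True /\ W (place fst p)) /\
  (True /\ W (place (fun _ => fst q) p)) /\ (True /\ W (place (fun _ => snd q) p)).
Let image (p : R * (R * R)) : R * (R * (R * R)) :=
  (fst (snd p), (family_fun psi (place fst p),
     (family_fun psi (place (fun _ => fst q) p), family_fun psi (place (fun _ => snd q) p)))).
(** The points [(x, (t, s))] for which [psi] is smooth at time [s] over [x] and over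
    both endpoints of [q], and [phi] is smooth at time [t] over their images. *)
Definition chi_domain (p : R * (R * R)) : Prop := Dom0 p /\ U (image p).

Let T (_ : R * (R * R)) := True.
Let HT : open T.
Proof. apply open_true. Qed.

Let place_map c : smooth T c -> smooth_map T (place c).
Proof.
  intros Hc.
  apply smooth_map_pair; [| apply smooth_map_pair; [| apply smooth_map_pair]];
    apply smooth_map_real.
  - exact (smooth_comp_snd T snd HT is_linear_snd).
  - exact Hc.
  - apply smooth_const, HT.
  - apply smooth_const, HT.
Qed.

Let open_place c : smooth T c -> open (fun p => True /\ W (place c p)).
Proof. intros Hc. apply (open_preimage T W (place c) HT HOW), place_map, Hc. Qed.

Let smooth_place c f :
  smooth T c -> smooth W f -> smooth (fun p => True /\ W (place c p)) (fun p => f (place c p)).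
Proof.
  intros Hc Hf.
  apply (smooth_comp T W (place c) f HT HOW); [apply place_map, Hc | exact Hf].
Qed.

Let Hfst : smooth T fst.
Proof. apply smooth_fst, HT. Qed.
Let Hcst c : smooth T (fun _ => c).
Proof. apply smooth_const, HT. Qed.

Let open_Dom0 : open Dom0.
Proof. apply open_and; [| apply open_and]; apply open_place; auto. Qed.

Let image_map : smooth_map Dom0 image.
Proof.
  pose proof HW as (_ & _ & Hpsi & _).
  apply smooth_map_pair; [| apply smooth_map_pair; [| apply smooth_map_pair]];
    apply smooth_map_real.
  - apply smooth_subset with (U := T); [intros; exact I |].
    exact (smooth_comp_snd T fst HT is_linear_fst).
  - apply smooth_subset with (2 := smooth_place fst _ Hfst Hpsi). unfold Dom0; tauto.
  - apply smooth_subset with (2 := smooth_place _ _ (Hcst (fst q)) Hpsi). unfold Dom0; tauto.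
  - apply smooth_subset with (2 := smooth_place _ _ (Hcst (snd q)) Hpsi). unfold Dom0; tauto.
Qed.

Lemma open_chi_domain : open chi_domain.
Proof using HU HW. exact (open_preimage Dom0 U image open_Dom0 HOU image_map). Qed.

Lemma smooth_fst_factor : smooth chi_domain fst_factor.
Proof using HU HW.
  pose proof HU as (_ & _ & _ & Hlog).
  pose proof (smooth_comp Dom0 U image _ open_Dom0 HOU image_map Hlog) as H.
  apply smooth_ext with (3 := H); [exact open_chi_domain |].
  intros p _. unfold fst_factor, image, place, family_fun. cbn [fst snd].
  rewrite <- surjective_pairing. reflexivity.
Qed.

Lemma smooth_snd_factor : smooth chi_domain snd_factor.
Proof using HU HW.
  pose proof HW as (_ & _ & _ & Hlog).
  pose proof (smooth_place fst _ Hfst (smooth_dirderiv W _ (0, (1, (0, 0))) Hlog)) as H.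
  apply smooth_ext with (f := fun p => Dx (family_log psi) (place fst p)).
  - exact open_chi_domain.
  - intros p _. unfold snd_factor, place. rewrite <- surjective_pairing. reflexivity.
  - apply smooth_subset with (2 := H). unfold chi_domain, Dom0. tauto.
Qed.

Lemma smooth_chi_integrand : smooth chi_domain chi_integrand.
Proof using HU HW.
  apply smooth_mult; [exact open_chi_domain | exact smooth_fst_factor | exact smooth_snd_factor].
Qed.

Lemma chi_domain_0 x : seg q x -> chi_domain (x, (0, 0)).
Proof using HU HW Hq psi_0.
  intros Hx. pose proof HU as (_ & HsU & _). pose proof HW as (_ & HsW & _).
  assert (Ht : Rabs 0 < eps) by (rewrite Rabs_R0; apply cond_pos).
  assert (H0 : Rabs 0 < eta) by (rewrite Rabs_R0; apply cond_pos).
  assert (Ha : seg q (fst q)) by (unfold P in Hq; unfold seg; lra).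
  assert (Hb : seg q (snd q)) by (unfold P in Hq; unfold seg; lra).
  unfold chi_domain, Dom0, image, place, family_fun. cbn [fst snd].
  rewrite <- !surjective_pairing, !psi_0 by assumption.
  rewrite <- !surjective_pairing. repeat split; auto.
Qed.

(** At the identity the second factor vanishes, is independent of [t], and the
    first factor vanishes too, so only one product survives. *)
Lemma mixed_chi_integrand (u v : R * R -> R -> R) x :
  (forall x, seg q x -> phi 0 q x = x) ->
  (forall x, seg q x -> is_derive (fun t => phi t q x) 0 (u q x)) ->
  (forall x, seg q x -> is_derive (fun t => psi t q x) 0 (v q x)) ->
  fst q < x < snd q ->
  dq (1, 0) (dq (0, 1) chi_integrand) (x, (0, 0)) = Derive (u q) x * Derive_n (v q) 2 x.
Proof using HU HW Hq psi_0.
  intros phi_0 phi_u psi_v Hx.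
  assert (Hsx : seg q x) by (unfold seg; lra).
  assert (Ha : seg q (fst q)) by (unfold P in Hq; unfold seg; lra).
  assert (Hb : seg q (snd q)) by (unfold P in Hq; unfold seg; lra).
  pose proof open_chi_domain as HO. pose proof smooth_fst_factor as HA.
  pose proof smooth_snd_factor as HB.
  assert (H0 : chi_domain (x, (0, 0))).
  { apply chi_domain_0, Hsx. }
  assert (EA : forall t, fst_factor (x, (t, 0)) = family_log phi (t, (x, q))).
  { intros t. unfold fst_factor. cbn [fst snd].
    rewrite !psi_0, <- surjective_pairing by assumption. reflexivity. }
  assert (A0 : fst_factor (x, (0, 0)) = 0).
  { rewrite EA. apply (family_log_0 phi q phi_0 x Hx). }
  assert (B0 : snd_factor (x, (0, 0)) = 0).
  { unfold snd_factor. cbn [fst snd]. apply (Dx_family_log_0 psi q psi_0 x Hx). }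
  assert (At : dq (1, 0) fst_factor (x, (0, 0)) = Derive (u q) x).
  { unfold dq. rewrite (dirderiv_line _ _ _ (fun t => (x, (t, 0)) : R * (R * R)) 0) by solve_line.
    rewrite (Derive_ext _ _ 0 EA), <- Dt_Derive.
    apply (Dt_family_log phi u eps U HU q Hq phi_0 phi_u x Hx). }
  assert (Bt : dq (1, 0) snd_factor (x, (0, 0)) = 0).
  { unfold dq. rewrite (dirderiv_line _ _ _ (fun t => (x, (t, 0)) : R * (R * R)) 0) by solve_line.
    exact (Derive_const (snd_factor (x, (0, 0))) 0). }
  assert (Bs : dq (0, 1) snd_factor (x, (0, 0)) = Derive_n (v q) 2 x).
  { unfold dq. rewrite (dirderiv_line _ _ _ (fun s => (x, (0, s)) : R * (R * R)) 0) by solve_line.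
    rewrite <- (Dt_Dx_family_log psi v eta W HW q Hq psi_0 psi_v x Hx).
    exact (eq_sym (Dt_Derive (Dx (family_log psi)) 0 x q)). }
  assert (HAs : smooth chi_domain (dq (0, 1) fst_factor)) by apply smooth_dq, HA.
  assert (HBs : smooth chi_domain (dq (0, 1) snd_factor)) by apply smooth_dq, HB.
  unfold dq at 1.
  rewrite (dirderiv_ext chi_domain _
    (fun p => dq (0, 1) fst_factor p * snd_factor p + fst_factor p * dq (0, 1) snd_factor p)
    _ _ HO); [| | exact H0].
  2:{ intros p Hp. apply (dirderiv_mult_on chi_domain); assumption. }
  rewrite (dirderiv_plus_on chi_domain), !(dirderiv_mult_on chi_domain);
    auto using smooth_mult.
  change (dirderiv snd_factor (0, (1, 0)) (x, (0, 0))) with (dq (1, 0) snd_factor (x, (0, 0))).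
  change (dirderiv fst_factor (0, (1, 0)) (x, (0, 0))) with (dq (1, 0) fst_factor (x, (0, 0))).
  rewrite A0, B0, At, Bt, Bs. ring.
Qed.

End Mixed.

Lemma is_derive_RInt_plane (D : R * (R * R) -> Prop) (G : R * (R * R) -> R) (a b : R)
    (p v : R * R) (c : R -> R * R) :
  open D -> smooth D G -> a <= b -> (forall x, a <= x <= b -> D (x, p)) ->
  (forall h : R, plus p (scal h v) = c h) ->
  is_derive (fun h : R => RInt (fun x => G (x, c h)) a b) 0
    (RInt (fun x => dq v G (x, p)) a b).
Proof.
  intros HD HG Hab HDp Hc.
  apply is_derive_ext with (f := fun h : R => RInt (fun x => G (x, plus p (scal h v))) a b).
  { intros h. rewrite Hc. reflexivity. }
  apply (is_derive_RInt_fixed D G a b p v HD HG Hab HDp).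
Qed.

Lemma chi_corresponding_cocycle : corresponding_cocycle chi Omega.
Proof.
  intros u v phi psi _ _ Hphi Hpsi q Hq.
  destruct (bisection_family_nbhd phi u Hphi) as (eps & U & HU).
  destruct (bisection_family_nbhd psi v Hpsi) as (eta & W & HW).
  destruct Hphi as (_ & _ & _ & Hphi), Hpsi as (_ & _ & _ & Hpsi).
  pose proof (fun x Hx => proj1 (Hphi q x Hq Hx)) as phi_0.
  pose proof (fun x Hx => proj2 (Hphi q x Hq Hx)) as phi_u.
  pose proof (fun x Hx => proj1 (Hpsi q x Hq Hx)) as psi_0.
  pose proof (fun x Hx => proj2 (Hpsi q x Hq Hx)) as psi_v.
  assert (Hab : fst q <= snd q) by (unfold P in Hq; lra).
  set (K1 := chi_integrand phi psi q). set (D1 := chi_domain psi q U W).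
  set (K2 := chi_integrand psi phi q). set (D2 := chi_domain phi q W U).
  assert (HD1 : open D1) by (eapply open_chi_domain; eassumption).
  assert (HD2 : open D2) by (eapply open_chi_domain; eassumption).
  assert (HK1 : smooth D1 K1) by (eapply smooth_chi_integrand; eassumption).
  assert (HK2 : smooth D2 K2) by (eapply smooth_chi_integrand; eassumption).
  assert (Hin1 : forall x, fst q <= x <= snd q -> D1 (x, (0, 0)))
    by (intros; eapply chi_domain_0; eassumption).
  assert (Hin2 : forall x, fst q <= x <= snd q -> D2 (x, (0, 0)))
    by (intros; eapply chi_domain_0; eassumption).
  assert (Hnear : locally 0 (fun t : R => forall x, fst q <= x <= snd q ->
            D1 (x, (t, 0)) /\ D2 (x, (0, t)))).
  { destruct (tube_locally (T := prod_UniformSpace R_UniformSpace R_UniformSpace)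
                (fst q) (snd q) (0, 0) (fun y => D1 y /\ D2 y) Hab) as [d Hd].
    { intros x Hx. apply filter_and; [apply HD1, Hin1, Hx | apply HD2, Hin2, Hx]. }
    exists d. intros t Ht x Hx.
    split; apply Hd; try exact Hx; split; first [exact Ht | apply ball_center]. }
  assert (EF : forall t s,
    chi (at_source (phi t) (trg (at_source (psi s) q))) (at_source (psi s) q)
    - chi (at_source (psi s) (trg (at_source (phi t) q))) (at_source (phi t) q) =
    RInt (fun x => K1 (x, (t, s))) (fst q) (snd q)
    - RInt (fun x => K2 (x, (s, t))) (fst q) (snd q)).
  { intros t s. apply (f_equal2 Rminus); apply chi_families. }
  (* First derivative, in [s] at [s = 0], for all small [t]. *)
  assert (HF : forall t, (forall x, fst q <= x <= snd q -> D1 (x, (t, 0)) /\ D2 (x, (0, t))) ->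
    is_derive (fun s =>
      chi (at_source (phi t) (trg (at_source (psi s) q))) (at_source (psi s) q)
      - chi (at_source (psi s) (trg (at_source (phi t) q))) (at_source (phi t) q)) 0
      (RInt (fun x => dq (0, 1) K1 (x, (t, 0))) (fst q) (snd q)
       - RInt (fun x => dq (1, 0) K2 (x, (0, t))) (fst q) (snd q))).
  { intros t Ht.
    apply is_derive_ext with (1 := fun s => eq_sym (EF t s)).
    apply (is_derive_minus (fun s => RInt (fun x => K1 (x, (t, s))) (fst q) (snd q))
             (fun s => RInt (fun x => K2 (x, (s, t))) (fst q) (snd q))).
    - apply (is_derive_RInt_plane D1); [exact HD1 | exact HK1 | exact Hab | apply Ht | solve_line].
    - apply (is_derive_RInt_plane D2); [exact HD2 | exact HK2 | exact Hab | apply Ht | solve_line]. }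
  split.
  - generalize Hnear. apply filter_imp. intros t Ht. eexists. apply HF, Ht.
  - apply is_derive_ext_loc with (f := fun t =>
      RInt (fun x => dq (0, 1) K1 (x, (t, 0))) (fst q) (snd q)
      - RInt (fun x => dq (1, 0) K2 (x, (0, t))) (fst q) (snd q)).
    { generalize Hnear. apply filter_imp. intros t Ht. symmetry.
      apply is_derive_unique, HF, Ht. }
    evar_last.
    + apply (is_derive_minus
        (fun t => RInt (fun x => dq (0, 1) K1 (x, (t, 0))) (fst q) (snd q))
        (fun t => RInt (fun x => dq (1, 0) K2 (x, (0, t))) (fst q) (snd q))).
      * apply (is_derive_RInt_plane D1 _ _ _ (0, 0) (1, 0));
          [exact HD1 | apply smooth_dq, HK1 | exact Hab | exact Hin1 | solve_line].
      * apply (is_derive_RInt_plane D2 _ _ _ (0, 0) (0, 1));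
          [exact HD2 | apply smooth_dq, HK2 | exact Hab | exact Hin2 | solve_line].
    + rewrite <- (RInt_minus (V := R_CompleteNormedModule)).
      * apply RInt_ext. rewrite Rmin_left, Rmax_right by exact Hab. intros x Hx.
        assert (E1 : dq (1, 0) (dq (0, 1) K1) (x, (0, 0))
                     = Derive (u q) x * Derive_n (v q) 2 x).
        { eapply mixed_chi_integrand; eassumption. }
        assert (E2 : dq (0, 1) (dq (1, 0) K2) (x, (0, 0))
                     = Derive (v q) x * Derive_n (u q) 2 x).
        { transitivity (dq (1, 0) (dq (0, 1) K2) (x, (0, 0))).
          - apply (dirderiv_comm D2); [exact HD2 | exact HK2 | apply Hin2; lra].
          - eapply mixed_chi_integrand; eassumption. }
        rewrite E1, E2, (Rmult_comm (Derive_n (u q) 2 x)). reflexivity.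
      * apply (smooth_ex_RInt D1); [apply smooth_dq, smooth_dq, HK1 |].
        rewrite Rmin_left, Rmax_right by exact Hab. exact Hin1.
      * apply (smooth_ex_RInt D2); [apply smooth_dq, smooth_dq, HK2 |].
        rewrite Rmin_left, Rmax_right by exact Hab. exact Hin2.
Qed.

Theorem proposition9p1 :
  (groupoid_cocycle chi /\ central_extension chi) /\
  (algebroid_cocycle Omega /\ corresponding_cocycle chi Omega).
Proof.
  split; split.
  - exact chi_groupoid_cocycle.
  - exact chi_central_extension.
  - exact Omega_algebroid_cocycle.
  - exact chi_corresponding_cocycle.
Qed.
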